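(* Let $K$ be an algebraically closed field of characteristic zero and $R=K[x,y,z]$. Let $d$ and $j$ be integers such that $1\le j\le\frac{d-1}{4}$, and consider the ideal $$I_j=(x^3,y^3,z^3,xyz)\cdot x^{d+1-4j}\cdot(x^4,y^4)^{j-1}+(y^d)+z^{4j+1}(y,z)^{d-1-4j}.$$ Then the following statements hold. (i) The algebra $R/I_j$ has the weak Lefschetz property in every degree $i\ne d-1$. More precisely, for a general linear form $\ell$, the map $\times\ell:[R/I_j]_{i-1}\to[R/I_j]_i$ is injective if $i<d$, and it is surjective if $i>d$. (ii) In degree $d-1$, $R/I_j$ fails the weak Lefschetz property by $j$. (iii) The variety $X_{2,[(I_j)^{-1}]_d}$ satisfies exactly $j$ Laplace equations of order $d-1$.
   Context: A graded algebra $A$ with Hilbert function $h_A(i)=\dim_K[A]_i$ fails the weak Lefschetz property in degree $i-1$ by $\delta$ if, for a general linear form $\ell$, the rank of $\times\ell:[A]_{i-1}\to[A]_i$ is $\min\{h_A(i-1),h_A(i)\}-\delta$; it has the weak Lefschetz property in degree $i-1$ if $\delta=0$. For an Artinian monomial ideal $I\subset R$ generated by $r$ monomials of degree $d$, $I^{-1}$ is the ideal generated by the Macaulay inverse system of $I$; $[I^{-1}]_d$ is spanned by the monomials of degree $d$ not in $I$. $X_{2,[I^{-1}]_d}$ denotes the (closure of the) image of the rational map $\mathbb{P}^2\dashrightarrow\mathbb{P}^{\binom{d+2}{2}-r-1}$ given by these monomials. For an $n$-dimensional projective variety $X\subset\mathbb{P}^N$ and a smooth point $P\in X$ with local parametrisation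 $\varphi$ around $P$ (in affine coordinates, with formal power series components), the $s$-th osculating space $T_P^{(s)}X$ is the projectivised span of the partial derivatives of $\varphi$ of order at most $s$ at $P$. $X$ satisfies $\delta$ Laplace equations of order $s$ if $\dim T_P^{(s)}X=\binom{n+s}{s}-1-\delta$ for a general point $P\in X$. *)

(* Defs.v *)
From HB Require Import structures.
From mathcomp Require Export all_boot all_order all_algebra.
From mathcomp Require Export boolp classical_sets.
From mathcomp Require Export mpoly.

Set Implicit Arguments.
Unset Strict Implicit.
Unset Printing Implicit Defensive.

Import GRing.Theory.
Local Open Scope ring_scope.

Section Ideals.
Variable R : comNzRingType.
Implicit Types (I J : R -> Prop).

Definition ideal_gen (s : seq R) : R -> Prop :=
  fun p => exists c : 'I_(size s) -> R, p = \sum_(i < size s) c i * s`_i.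

Definition ideal_add I J : R -> Prop :=
  fun p => exists a b, [/\ I a, J b & p = a + b].

Definition ideal_mul I J : R -> Prop :=
  fun p => exists2 s : seq (R * R),
    {in s, forall ab, I ab.1 /\ J ab.2} & p = \sum_(ab <- s) ab.1 * ab.2.

Definition ideal_exp I (k : nat) : R -> Prop :=
  iter k (ideal_mul I) (ideal_gen [:: 1]).

End Ideals.

Section Lefschetz.
Variables (K : fieldType) (n : nat).
Local Notation R := {mpoly K[n.+1]}.
Local Notation "''R_' i" := (dhomog n.+1 K i) (at level 8, i at level 2).
Implicit Types (I : R -> Prop) (i : nat).

(* [I]_i as a subspace of [R]_i; see [mem_graded_piece]. The default value is
   only reached when I is not stable under linear combinations. *)
Definition graded_piece I i : {vspace 'R_i} :=
  xget 0%VS [set W : {vspace 'R_i} | forall p : 'R_i, p \in W <-> I p]%classic.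

Lemma mem_graded_piece I i (p : 'R_i) :
    I 0 -> (forall (c : K) (f g : R), I f -> I g -> I (c *: f + g)) ->
  p \in graded_piece I i <-> I p.
Proof.
move=> I0 Ilin; suff [W hW] : exists W : {vspace 'R_i},
    forall q : 'R_i, q \in W <-> I q.
  by rewrite /graded_piece; case: xgetP => [V _ /(_ p)|/(_ W)/(_ hW)].
pose P k := `[< exists2 W : {vspace 'R_i},
                  \dim W = k & forall q : 'R_i, q \in W -> I q >].
have exP : exists k, P k.
  exists 0%N; apply/asboolP; exists 0%VS; first exact: dimv0.
  by move=> q; rewrite memv0 => /eqP ->.
have leP k : P k -> (k <= \dim {:'R_i})%N.
  by case/asboolP => W <- _; exact/dimvS/subvf.
case: (ex_maxnP exP leP) => k /asboolP[W dW WI] maxk.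
exists W => q; split=> [|Iq]; first exact: WI.
have /maxk : P (\dim (<[q]> + W)).
  apply/asboolP; exists (<[q]> + W)%VS => // r.
  case/memv_addP => _ /vlineP[c ->] [w Ww ->].
  by apply: Ilin => //; exact: WI.
rewrite -dW => le_dim; have /eqP-> : W == (<[q]> + W)%VS.
  by rewrite eqEdim addvSr le_dim.
by apply: (subvP (addvSl _ _)); exact: memv_line.
Qed.

Definition hilbert I i : nat := \dim {:'R_i} - \dim (graded_piece I i).

Definition mul_form i (l : 'R_1) (p : 'R_i) : 'R_(i.+1) :=
  DHomog (dhomogM (dhomog_is_dhomog l) (dhomog_is_dhomog p)).

Lemma mul_form_is_linear i (l : 'R_1) : linear (@mul_form i l).
Proof. by move=> c p q; apply/val_inj; rewrite /= mulrDr -scalerAr. Qed.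

(* rank of the induced map [R/I]_i -> [R/I]_{i+1}, whose image is
   (l [R]_i + [I]_{i+1}) / [I]_{i+1} *)
Definition mul_rank I i (l : 'R_1) : nat :=
  \dim (limg (linfun (@mul_form i l)) + graded_piece I i.+1)
  - \dim (graded_piece I i.+1).

Definition mul_injective I i (l : 'R_1) : Prop :=
  forall p : 'R_i, I (mul_form l p) -> I p.

Definition mul_surjective I i (l : 'R_1) : Prop :=
  forall q : 'R_(i.+1), exists p : 'R_i, I ((q : R) - mul_form l p).

(* "for a general linear form": on a nonempty basic open subset of the affine
   space [R]_1, whose coordinates are the coefficients of the form *)
Definition general_form (P : 'R_1 -> Prop) : Prop :=
  exists2 g : R, g != 0 &
    forall l : 'R_1, g.@[fun k => (l : R)@_U_(k)] != 0 -> P l.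

Definition fails_WLP_by I i (delta : nat) : Prop :=
  general_form (fun l =>
    (mul_rank I i l + delta = minn (hilbert I i) (hilbert I i.+1))%N).

Definition has_WLP_in_degree I i : Prop := fails_WLP_by I i 0.

End Lefschetz.

Section PowerSeries.
Variables (K : fieldType) (n : nat).

Definition fps := 'X_{1..n} -> K.

Definition fps1 : fps := fun mu => (mu == 0%MM)%:R.

Definition fps_trunc (k : nat) (c : fps) : {mpoly K[n]} :=
  \sum_(nu : 'X_{1..n < k.+1}) c nu *: 'X_[nu].

(* f(phi_1, ..., phi_m); its coefficient at t^mu only involves the terms of
   the phi_i of degree at most |mu| *)
Definition fps_subst (m : nat) (f : {mpoly K[m]}) (phi : 'I_m -> fps) : fps :=
  fun mu => (f \mPo [tuple fps_trunc (mdeg mu) (phi i) | i < m])@_mu.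

Definition fps_mderiv (nu : 'X_{1..n}) (c : fps) : fps :=
  fun mu => c (mu + nu)%MM *+ \prod_(i < n) (mu i + nu i) ^_ (nu i).

End PowerSeries.

(* A point of P^(m-1) is given by homogeneous coordinates P : 'I_m -> K, and a
   subset of P^(m-1) by a predicate on nonzero vectors, stable under scaling. *)
Section Projective.
Variables (K : fieldType) (m : nat).
Implicit Types (X : ('I_m -> K) -> Prop) (P : 'I_m -> K).

Definition nonzero_vec P : Prop := exists i, P i != 0.

Definition vanishes_on (f : {mpoly K[m]}) X : Prop :=
  forall P, X P -> f.@[P] = 0.

Definition zariski_closure (S : ('I_m -> K) -> Prop) : ('I_m -> K) -> Prop :=
  fun P => nonzero_vec P /\
    forall (e : nat) (f : {mpoly K[m]}),
      f \is e.-homog -> vanishes_on f S -> f.@[P] = 0.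

(* algebraic independence of the classes of f_1, ..., f_k in the homogeneous
   coordinate ring of X *)
Definition alg_independent_on X (k : nat) (f : k.-tuple {mpoly K[m]}) : Prop :=
  forall g : {mpoly K[k]}, vanishes_on (g \mPo f) X -> g = 0.

(* the homogeneous coordinate ring of X has transcendence degree n + 1 *)
Definition has_dim X (n : nat) : Prop :=
  (exists f : n.+1.-tuple {mpoly K[m]}, alg_independent_on X f) /\
  ~ (exists f : n.+2.-tuple {mpoly K[m]}, alg_independent_on X f).

(* Jacobian criterion, on the affine cone over the n-dimensional variety X *)
Definition smooth_point X (n : nat) P : Prop :=
  X P /\ exists2 T : {vspace 'rV[K]_m}, \dim T = n.+1 &
    forall v : 'rV[K]_m, v \in T <->
      (forall f, vanishes_on f X -> \sum_(i < m) v 0 i * (f^`M(i)).@[P] = 0).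

Definition deriv_row (n : nat) (phi : 'I_m -> fps K n) (nu : 'X_{1..n}) :
  'rV[K]_m := \row_i fps_mderiv nu (phi i) 0%MM.

(* formal parametrisation of X around P in the affine chart where the k-th
   coordinate is 1 *)
Definition local_param X (n : nat) P (phi : 'I_m -> fps K n) : Prop :=
  [/\ exists k, [/\ P k != 0, phi k = @fps1 K n
                  & forall i, phi i 0%MM = P i / P k],
      forall f, vanishes_on f X -> forall mu, fps_subst f phi mu = 0
    & free [seq deriv_row phi U_(a)%MM | a : 'I_n]].

(* T_P^(s) X is the projectivisation of this space, so that its projective
   dimension is one less than [\dim]; at a smooth point of an n-dimensional X
   it does not depend on the choice of the local parametrisation phi *)
Definition osc_span (n s : nat) (phi : 'I_m -> fps K n) : {vspace 'rV[K]_m} :=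
  <<[seq deriv_row phi (val nu) | nu : 'X_{1..n < s.+1}]>>%VS.

(* "for a general point of X": on a nonempty basic open subset of X *)
Definition general_point X (Q : ('I_m -> K) -> Prop) : Prop :=
  exists2 eg : nat * {mpoly K[m]},
    eg.2 \is (eg.1).-homog /\ ~ vanishes_on eg.2 X &
    forall P, X P -> eg.2.@[P] != 0 -> Q P.

Definition satisfies_laplace X (s delta : nat) : Prop :=
  exists2 n, has_dim X n &
    general_point X (fun P => smooth_point X n P /\
      exists2 phi : 'I_m -> fps K n, local_param X P phi &
        ((\dim (osc_span s phi))%:Z - 1 = 'C(n + s, s)%:Z - 1 - delta%:Z)).

End Projective.

Section MonomialVariety.
Variables (K : fieldType) (n : nat).
Implicit Types (I : {mpoly K[n.+1]} -> Prop) (d : nat).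

(* the monomials of degree d not in I, a basis of [I^-1]_d *)
Definition inv_monomials I d : seq 'X_{1..n.+1} :=
  [seq val mu | mu : 'X_{1..n.+1 < d.+1} <- enum {: 'X_{1..n.+1 < d.+1}}
     & (mdeg mu == d) && ~~ `[< I 'X_[mu] >]].

Definition monomial_map (s : seq 'X_{1..n.+1}) (a : 'I_n.+1 -> K) :
  'I_(size s) -> K := fun i => ('X_[nth 0%MM s i] : {mpoly K[n.+1]}).@[a].

Definition inverse_system_variety I d :
    ('I_(size (inv_monomials I d)) -> K) -> Prop :=
  zariski_closure (fun P => nonzero_vec P /\
    exists a, P = @monomial_map (inv_monomials I d) a).

End MonomialVariety.

Definition ideal_I (K : fieldType) (d j : nat) : {mpoly K[3]} -> Prop :=
  let x : {mpoly K[3]} := 'X_0 in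
  let y : {mpoly K[3]} := 'X_1 in
  let z : {mpoly K[3]} := 'X_2 in
  ideal_add
    (ideal_add
      (ideal_mul
        (ideal_mul (ideal_gen [:: x ^+ 3; y ^+ 3; z ^+ 3; x * y * z])
                   (ideal_gen [:: x ^+ (d + 1 - 4 * j)]))
        (ideal_exp (ideal_gen [:: x ^+ 4; y ^+ 4]) (j - 1)))
      (ideal_gen [:: y ^+ d]))
    (ideal_mul (ideal_gen [:: z ^+ (4 * j + 1)])
               (ideal_exp (ideal_gen [:: y; z]) (d - 1 - 4 * j))).

(* Main.v *)
(** Let l = ax + by + cz with abc <> 0. Rescaling the variables, restriction to the
    line l = 0 is the substitution x := 1, y := t, z := -(1 + t), and the d + 1
    generators of I_j become 4j polynomials in blocks of four,
    t^(4k), t^(4k+1)(1+t), t^(4k)(1+t)^3, t^(4k+3), together with t^d and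
    (1+t)^(4j+1) times all polynomials of degree < d - 4j. The Togliatti relation
    x^3 + y^3 + z^3 - 3xyz = (x + y + z)(...) makes one polynomial of each block
    redundant, so the restriction of [I_j]_d has dimension at most d + 1 - j. It is
    exactly d + 1 - j, because adding the j polynomials t^(4k+1) gives everything: the
    only point is to reach t^(4j), and it is obtained by reducing t^d modulo
    (1+t)^(4j+1). This yields (ii); multiplying once by x and y fills the whole space in
    degree d + 1, which yields (i).

    For (iii), the monomials of degree d outside I_j contain three neighbours m, my/x,
    mz/x, so the points of X with nonzero coordinates form the image of the torus. At
    such a point exponentials parametrise X, and the osculating space of order d - 1 is,
    up to a diagonal scaling, the space of polynomials of degree < d on the exponents s
    of these monomials. On the plane |s| = d it is spanned by the falling factorials
    s(s-1)...(s-u+1) with |u| = d - 1, which vanish unless s is u plus a unit vector: up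
    to scaling this is the matrix of multiplication by x + y + z, whose rank is given
    by (ii). *)
From HB Require Import structures.
Require Import Defs.
From mathcomp Require Import zify ring.
Import GRing.Theory.
Local Open Scope ring_scope.

Set Implicit Arguments.
Unset Strict Implicit.
Unset Printing Implicit Defensive.

(** * Monomial ideals *)

Section MonomialIdeals.
Variables (K : fieldType) (n : nat).
Local Notation R := {mpoly K[n]}.
Implicit Types (U V : 'X_{1..n} -> Prop) (p q : R).

(** For arbitrary [U] this is only the span of the monomials with exponent in [U], an ideal once [U]
    is up-closed. Sums and products of ideals thereby become operations on predicates on
    exponents. *)
Definition monomial_ideal U : R -> Prop :=
  fun p => forall m, m \in msupp p -> U m.

Lemma monomial_idealX U m : monomial_ideal U 'X_[m] <-> U m.
Proof.
split=> [|Um k]; first by apply; rewrite msuppX inE.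
by rewrite msuppX inE => /eqP->.
Qed.

Lemma monomial_ideal0 U : monomial_ideal U 0.
Proof. by move=> m; rewrite msupp0. Qed.

Lemma monomial_idealD U p q :
  monomial_ideal U p -> monomial_ideal U q -> monomial_ideal U (p + q).
Proof.
by move=> Up Uq m /msuppD_le; rewrite mem_cat => /orP[/Up|/Uq].
Qed.

Lemma monomial_idealZ U c p : monomial_ideal U p -> monomial_ideal U (c *: p).
Proof. by move=> Up m /msuppZ_le/Up. Qed.

Lemma monomial_idealZX U c m : U m -> monomial_ideal U (c *: 'X_[m]).
Proof. by move=> Um; apply: monomial_idealZ; apply/monomial_idealX. Qed.

Lemma monomial_ideal_sum U (I : Type) (r : seq I) (P : pred I) (F : I -> R) :
  (forall i, P i -> monomial_ideal U (F i)) ->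
  monomial_ideal U (\sum_(i <- r | P i) F i).
Proof.
by apply: big_ind; [exact: monomial_ideal0 | exact: monomial_idealD].
Qed.

Definition up_closed U := forall m k, U m -> U (m + k)%MM.

Lemma monomial_idealM U p q :
  up_closed U -> monomial_ideal U p -> monomial_ideal U (p * q).
Proof.
move=> upU Up m /msuppM_le /allpairsP[[a b] /= [/Up Ua _ ->]].
exact: upU.
Qed.

Lemma ideal_addE U V : ideal_add (monomial_ideal U) (monomial_ideal V)
  = monomial_ideal (fun m => U m \/ V m).
Proof.
apply/funext => p; apply/propext; split=> [[a [b [Ua Vb ->]]] m|UVp].
  by move/msuppD_le; rewrite mem_cat => /orP[/Ua|/Vb]; [left|right].
exists (\sum_(m <- msupp p | `[< U m >]) p@_m *: 'X_[m]),
       (\sum_(m <- msupp p | ~~ `[< U m >]) p@_m *: 'X_[m]); split.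
- apply: monomial_ideal_sum => m /= /asboolP Um.
  exact: monomial_idealZX.
- rewrite big_seq_cond; apply: monomial_ideal_sum => m /= /andP[mp /asboolP nUm].
  by apply: monomial_idealZX; case: (UVp m mp).
- by rewrite [LHS]mpolyE (bigID (fun m => `[< U m >])).
Qed.

Lemma ideal_mulE U V : ideal_mul (monomial_ideal U) (monomial_ideal V)
  = monomial_ideal (fun m => exists a b, [/\ U a, V b & m = (a + b)%MM]).
Proof.
apply/funext => p; apply/propext; split=> [[s sUV ->]|UVp].
  rewrite big_seq; apply: monomial_ideal_sum => -[f g] /sUV /= [Uf Vg] m.
  by move/msuppM_le/allpairsP => [[a b] /= [/Uf Ua /Vg Vb ->]]; exists a, b.
(* [dec m] chooses a factorisation of [m]; its default value is not reached on the support of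
   [p]. *)
pose dec m : 'X_{1..n} * 'X_{1..n} :=
  xget (0%MM, 0%MM) [set ab | [/\ U ab.1, V ab.2 & m = (ab.1 + ab.2)%MM]]%classic.
have decP m : m \in msupp p -> [/\ U (dec m).1, V (dec m).2 & m = ((dec m).1 + (dec m).2)%MM].
  by move/UVp => [a [b UV]]; rewrite /dec; case: xgetP => [? ->|/(_ (a, b))/(_ UV)].
exists [seq (p@_m *: 'X_[(dec m).1], 'X_[(dec m).2]) | m <- msupp p].
  move=> ab /mapP[m /decP[Ua Vb _] ->] /=; split; last exact/monomial_idealX.
  exact: monomial_idealZX.
rewrite big_map [LHS]mpolyE big_seq [RHS]big_seq; apply: eq_bigr => m /decP[_ _ mE] /=.
by rewrite -scalerAl -mpolyXD -mE.
Qed.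

Lemma ideal_genE (s : seq 'X_{1..n}) :
  ideal_gen [seq ('X_[m] : R) | m <- s]
  = monomial_ideal (fun m => exists2 a, a \in s & (a <= m)%MM).
Proof.
apply/funext => p; apply/propext; split=> [[c ->]|Up].
  apply: monomial_ideal_sum => i _ m.
  have lti : (i < size s)%N by rewrite -[ltnRHS](size_map (fun m => 'X_[K, m])).
  rewrite (nth_map 0%MM) // => /msuppM_le /allpairsP[[a b] /= [_]].
  rewrite msuppX inE => /eqP-> ->.
  by exists (nth 0%MM s i); rewrite ?mem_nth // lem_addl.
have gen0 : ideal_gen [seq ('X_[m] : R) | m <- s] 0.
  by exists (fun=> 0); rewrite big1 // => i _; rewrite mul0r.
have genD f g : ideal_gen [seq ('X_[m] : R) | m <- s] f ->
    ideal_gen [seq ('X_[m] : R) | m <- s] g ->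
    ideal_gen [seq ('X_[m] : R) | m <- s] (f + g).
  move=> [c ->] [e ->]; exists (fun i => c i + e i).
  by rewrite -big_split; apply: eq_bigr => i _; rewrite mulrDl.
rewrite [p]mpolyE big_seq; apply: (big_ind _ gen0 genD) => m /Up[a a_s le_am].
have lta : (index a s < size [seq ('X_[m] : R) | m <- s])%N.
  by rewrite size_map index_mem.
exists (fun i => if i == Ordinal lta then p@_m *: 'X_[m - a] else 0).
rewrite (bigD1 (Ordinal lta)) //= eqxx big1 ?addr0 => [|i /negPf->]; last by rewrite mul0r.
by rewrite (nth_map 0%MM) ?index_mem // nth_index // -scalerAl -mpolyXD submK.
Qed.

Lemma ideal_exp2E (u v : 'X_{1..n}) k :
  ideal_exp (ideal_gen [:: 'X_[u]; 'X_[v] : R]) k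
  = monomial_ideal
      (fun m => exists2 i, (i <= k)%N & (u *+ i + v *+ (k - i) <= m)%MM).
Proof.
have lepm (a b : 'X_{1..n}) : (a <= b)%MM <-> (forall t, a t <= b t)%N.
  by split=> [/mnm_lepP|? ]; last apply/mnm_lepP.
elim: k => [|k IH].
  rewrite /ideal_exp /= -(mpolyX0 n K) (ideal_genE [:: 0%MM]).
  congr monomial_ideal; apply/funext => m; apply/propext; split=> [[a _ _]|_].
    by exists 0%N; rewrite // !mulm0n addm0; apply/lepm => t; rewrite mnm0E.
  by exists 0%MM; rewrite ?inE //; apply/lepm => t; rewrite mnm0E.
rewrite /ideal_exp iterS -/(ideal_exp _ k) IH (ideal_genE [:: u; v]) ideal_mulE.
congr monomial_ideal; apply/funext => m; apply/propext; split.
  move=> [a [b [[w]]]]; rewrite !inE => /orP[/eqP->|/eqP->] /lepm wa [i ik /lepm le_b] ->.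
    exists i.+1; rewrite // subSS; apply/lepm => t; move: (wa t) (le_b t).
    by rewrite !mnmDE !mulmnE; lia.
  exists i; first exact: leqW.
  rewrite subSn //; apply/lepm => t; move: (wa t) (le_b t).
  by rewrite !mnmDE !mulmnE; lia.
move=> [i]; case: i => [|i] ik /lepm le_m.
  exists v, (m - v)%MM; split.
  - by exists v; rewrite ?inE ?eqxx ?orbT // lepm_refl.
  - exists 0%N => //; apply/lepm => t; move: (le_m t).
    by rewrite !mnmDE !mulmnE mnmBE; lia.
  - rewrite addmC submK //; apply/lepm => t; move: (le_m t).
    by rewrite !mnmDE !mulmnE; lia.
exists u, (m - u)%MM; split.
- by exists u; rewrite ?inE ?eqxx ?orbT // lepm_refl.
- exists i => //; apply/lepm => t; move: (le_m t).
  by rewrite !mnmDE !mulmnE mnmBE; lia.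
- rewrite addmC submK //; apply/lepm => t; move: (le_m t).
  by rewrite !mnmDE !mulmnE; lia.
Qed.
End MonomialIdeals.

(** * The monomial generators of I_j *)

Definition mnm3 (a b c : nat) : 'X_{1..3} :=
  [multinom nth 0%N [:: a; b; c] i | i < 3].

Lemma mnm3E a b c :
  ((mnm3 a b c 0%R = a) * (mnm3 a b c 1%R = b) * (mnm3 a b c 2%R = c))%type.
Proof. by rewrite !mnmE. Qed.

Lemma forall_ord3 (P : 'I_3 -> Prop) :
  (forall t, P t) <-> [/\ P 0, P 1 & P 2].
Proof.
split=> [H|[P0 P1 P2] t]; first by split.
case: t => [[|[|[|//]]] lt].
- by have -> : Ordinal lt = 0 by apply/val_inj.
- by have -> : Ordinal lt = 1 by apply/val_inj.
- by have -> : Ordinal lt = 2 by apply/val_inj.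
Qed.

Lemma mnm3P (m m' : 'X_{1..3}) :
  m = m' <-> [/\ m 0 = m' 0, m 1 = m' 1 & m 2 = m' 2].
Proof.
split=> [-> //|/(iffRL (forall_ord3 (fun t => m t = m' t))) E].
by apply/mnmP.
Qed.

Lemma lepm3P (m m' : 'X_{1..3}) :
  (m <= m')%MM <-> [/\ m 0%R <= m' 0%R, m 1%R <= m' 1%R & m 2%R <= m' 2%R]%N.
Proof. by rewrite -(forall_ord3 (fun t => m t <= m' t)%N); split=> /mnm_lepP. Qed.

Lemma mdeg3 (m : 'X_{1..3}) : mdeg m = (m 0%R + m 1%R + m 2%R)%N.
Proof.
rewrite mdegE !big_ord_recr big_ord0 /= add0n.
by congr (m _ + m _ + m _)%N; apply/val_inj.
Qed.

(* The i-th generator of I_j. The block of the first product with y-exponent 4k is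
   indexed by 4k + r, r < 4, in the order of [gen_mnm_blockP]. *)
Definition gen_mnm (d j i : nat) : 'X_{1..3} :=
  if (i < 4 * j)%N then
    if (i %% 4 == 1)%N then mnm3 (d - 1 - i) i 1
    else if (i %% 4 == 2)%N then mnm3 (d - 1 - i) (i - 2) 3
    else mnm3 (d - i) i 0
  else if (i == 4 * j)%N then mnm3 0 d 0
  else mnm3 0 (d - i) i.

Definition in_genI (d j : nat) (m : 'X_{1..3}) : Prop :=
  exists2 i, (i <= d)%N & (gen_mnm d j i <= m)%MM.

Lemma gen_mnm_blockP d j k r : (k < j)%N -> (r < 4)%N ->
  gen_mnm d j (4 * k + r) =
    nth 0%MM [:: mnm3 (d - 4 * k) (4 * k) 0; mnm3 (d - 2 - 4 * k) (4 * k + 1) 1;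
       mnm3 (d - 3 - 4 * k) (4 * k) 3; mnm3 (d - 3 - 4 * k) (4 * k + 3) 0] r.
Proof.
move=> kj r4; rewrite /gen_mnm.
have -> : (4 * k + r < 4 * j)%N by lia.
have -> : ((4 * k + r) %% 4 = r)%N by lia.
by case: r r4 => [|[|[|[|//]]]] _ /=; congr mnm3; lia.
Qed.

Section IdealI.
Variables (K : fieldType) (d j : nat).
Hypotheses (j_ge1 : (1 <= j)%N) (j_le : (4 * j <= d - 1)%N).

Lemma ideal_IE : @ideal_I K d j = monomial_ideal (in_genI d j).
Proof.
rewrite /ideal_I !mpolyXn -!mpolyXD.
pose l1 : seq 'X_{1..3} :=
  [:: U_(0%R) *+ 3; U_(1%R) *+ 3; U_(2%R) *+ 3; U_(0%R) + U_(1%R) + U_(2%R)]%MM.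
rewrite (ideal_genE K l1).
rewrite (ideal_genE K [:: U_(0%R) *+ (d + 1 - 4 * j)]%MM).
rewrite (ideal_genE K [:: U_(1%R) *+ d]%MM).
rewrite (ideal_genE K [:: U_(2%R) *+ (4 * j + 1)]%MM).
rewrite !ideal_exp2E !ideal_mulE !ideal_addE.
have cE (a b : 'I_3) : U_(a)%MM b = (a == b :> nat) by rewrite mnm1E.
congr monomial_ideal; apply/funext => m; apply/propext; split.
  move=> [[|]|].
  - move=> [a [b [[a1 [a2 [[w wl wa1] [w2]]]]]]].
    rewrite inE => /eqP-> {w2} /lepm3P[]; rewrite !mulmnE !cE /= => h0 _ _ ->.
    move=> [i ij] /lepm3P[]; rewrite !mnmDE !mulmnE !cE /= => i0 i1 i2 /mnm3P[].
    rewrite !mnmDE => m0 m1 m2.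
    (* [i] is the exponent of x^4 in the factor from (x^4, y^4)^(j-1), so [k] is that of y^4 and
       numbers the block. *)
    pose k := (j - 1 - i)%N.
    have kj : (k < j)%N by lia.
    have U r : (r < 4)%N -> (gen_mnm d j (4 * k + r) <= m)%MM -> in_genI d j m.
      by move=> r4; exists (4 * k + r)%N => //; lia.
    move: wl wa1; rewrite !inE => /or4P[]/eqP-> /lepm3P[];
      rewrite ?mnmDE ?mulmnE ?cE /= => w0 w1 w2.
    + apply: (U 0%N) => //; rewrite gen_mnm_blockP //=.
      by apply/lepm3P; rewrite !mnm3E; split; lia.
    + apply: (U 3) => //; rewrite gen_mnm_blockP //=.
      by apply/lepm3P; rewrite !mnm3E; split; lia.
    + apply: (U 2) => //; rewrite gen_mnm_blockP //=.
      by apply/lepm3P; rewrite !mnm3E; split; lia.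
    + apply: (U 1%N) => //; rewrite gen_mnm_blockP //=.
      by apply/lepm3P; rewrite !mnm3E; split; lia.
  - move=> [a]; rewrite inE => /eqP-> /lepm3P[]; rewrite !mulmnE !cE /= => _ h1 _.
    exists (4 * j)%N; first lia.
    rewrite /gen_mnm ltnn eqxx; apply/lepm3P; rewrite !mnm3E; split; lia.
  - move=> [a [b [[w]]]]; rewrite inE => /eqP-> /lepm3P[].
    rewrite !mulmnE !cE /= => a0 a1 a2 [i id] /lepm3P[].
    rewrite !mnmDE !mulmnE !cE /= => b0 b1 b2 /mnm3P[]; rewrite !mnmDE => m0 m1 m2.
    (* Here [i] is the exponent of y from (y, z)^(d-1-4j), and y^i z^(d-i) is the generator with
       index [d - i]. *)
    exists (d - i)%N; first lia.
    rewrite /gen_mnm ifN; last lia.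
    by rewrite ifN; last lia; apply/lepm3P; rewrite !mnm3E; split; lia.
have subm (u : 'X_{1..3}) : (u <= m)%MM -> m = (u + (m - u))%MM.
  by move=> le; rewrite addmC submK.
move=> [i id]; case: (ltnP i (4 * j)) => [ij|ji].
  pose k := (i %/ 4)%N; have kj : (k < j)%N by lia.
  have r4 : (i %% 4 < 4)%N by lia.
  rewrite (_ : i = (4 * k + i %% 4)%N); last by lia.
  rewrite gen_mnm_blockP // => le; left; left.
  (* [v] comes from (x^4, y^4)^(j-1), [w] is x^(d+1-4j), and [u] will be one of the four cubics; the
     rest of [m] is absorbed into the factor of [v]. *)
  pose v := (U_(0%R) *+ (4 * (j - 1 - k)) + U_(1%R) *+ (4 * k))%MM : 'X_{1..3}.
  pose w := (U_(0%R) *+ (d + 1 - 4 * j))%MM : 'X_{1..3}.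
  have [u ul uE] : exists2 u, u \in l1 & (u + w + v <= m)%MM.
    case: (i %% 4)%N r4 le => [|[|[|[|//]]]] _ /lepm3P[]; rewrite /= !mnm3E => m0 m1 m2.
    - exists (U_(0%R) *+ 3)%MM; rewrite ?inE ?eqxx ?orbT //.
      by apply/lepm3P; rewrite !mnmDE !mulmnE !cE /=; split; lia.
    - exists (U_(0%R) + U_(1%R) + U_(2%R))%MM; rewrite ?inE ?eqxx ?orbT //.
      by apply/lepm3P; rewrite !mnmDE !mulmnE !cE /=; split; lia.
    - exists (U_(2%R) *+ 3)%MM; rewrite ?inE ?eqxx ?orbT //.
      by apply/lepm3P; rewrite !mnmDE !mulmnE !cE /=; split; lia.
    - exists (U_(1%R) *+ 3)%MM; rewrite ?inE ?eqxx ?orbT //.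
      by apply/lepm3P; rewrite !mnmDE !mulmnE !cE /=; split; lia.
  exists (u + w)%MM, (v + (m - (u + w + v)))%MM; split.
  - exists u, w; split=> //; first by exists u; rewrite ?lepm_refl.
    by exists w; rewrite ?inE ?lepm_refl.
  - exists (j - 1 - k)%N; first lia.
    by apply/lepm3P; rewrite !mnmDE !mulmnE !cE /=; split; lia.
  - by rewrite addmA -subm.
rewrite /gen_mnm ifN; last lia.
case: eqP => [_|ne] /lepm3P[]; rewrite !mnm3E => m0 m1 m2.
  left; right; exists (U_(1%R) *+ d)%MM; rewrite ?inE //.
  by apply/lepm3P; rewrite !mulmnE !cE /=; split; lia.
right; exists (U_(2%R) *+ (4 * j + 1))%MM, (m - U_(2%R) *+ (4 * j + 1))%MM; split.
- by exists (U_(2%R) *+ (4 * j + 1))%MM; rewrite ?inE ?lepm_refl.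
- exists (d - i)%N; first lia.
  by apply/lepm3P; rewrite !mnmDE !mnmBE !mulmnE !cE /=; split; lia.
- by apply: subm; apply/lepm3P; rewrite !mulmnE !cE /=; split; lia.
Qed.

End IdealI.

(** * Monomial bases of graded pieces *)

Section HomogeneousPieces.
Variables (K : fieldType) (n : nat).
Local Notation R := {mpoly K[n.+1]}.
Implicit Types (U : 'X_{1..n.+1} -> Prop).

Lemma val_indhomog e (p : R) : p \is e.-homog -> indhomog e p = p :> R.
Proof. by move=> hp; rewrite /indhomog insubdK. Qed.

Lemma val_indhomogX e (m : 'X_{1..n.+1}) :
  mdeg m = e -> indhomog e 'X_[m] = 'X_[m] :> R.
Proof. by move=> me; rewrite val_indhomog // dhomogX; apply/eqP. Qed.

Lemma mdeg_msupp_dhomog e (p : dhomog n.+1 K e) m : m \in msupp (p : R) -> mdeg m = e.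
Proof. by move/(dhomogP mdeg e _): (dhomog_is_dhomog p) => h /h. Qed.

Lemma mem_graded_monomial U e (p : dhomog n.+1 K e) :
  p \in graded_piece (monomial_ideal (K := K) U) e <-> monomial_ideal U p.
Proof.
apply: mem_graded_piece; first exact: monomial_ideal0.
move=> c f g Uf Ug; apply: monomial_idealD => //; exact: monomial_idealZ.
Qed.

Lemma dim_dhomog e : \dim {: dhomog n.+1 K e} = 'C(e + n, e).
Proof. by rewrite dimvf. Qed.

Lemma free_monomials e (s : seq 'X_{1..n.+1}) :
  uniq s -> all (fun m => mdeg m == e) s ->
  free [seq (indhomog e 'X_[m] : dhomog n.+1 K e) | m <- s].
Proof.
move=> us /allP degs; set X := map _ s.
have szX : size X = size s by rewrite size_map.
apply/(@freeP _ _ _ (in_tuple X)) => k /(congr1 (@mpoly_of_dhomog _ _ _)) kX i.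
have lt (l : 'I_(size X)) : (l < size s)%N by rewrite -szX.
have sE (l : 'I_(size X)) : X`_l = 'X_[nth 0%MM s l] :> R.
  rewrite (nth_map 0%MM) // val_indhomogX //.
  by apply/eqP/degs/mem_nth.
move/(congr1 (mcoeff (nth 0%MM s i))): kX.
rewrite (raddf_sum (@mpoly_of_dhomog _ _ _)) raddf_sum (bigD1 i) //= big1 => [|l li].
  by rewrite sE mcoeffZ mcoeffX eqxx mulr1 addr0 mcoeff0.
by rewrite sE mcoeffZ mcoeffX nth_uniq // (negPf (_ : l != i :> nat)) ?mulr0.
Qed.

Lemma dhomogE_sum e (p : dhomog n.+1 K e) :
  p = \sum_(m <- msupp (p : R)) (p : R)@_m *: (indhomog e 'X_[m]).
Proof.
apply/val_inj => /=; rewrite raddf_sum /= [LHS]mpolyE.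
rewrite big_seq [RHS]big_seq; apply: eq_bigr => m /mdeg_msupp_dhomog me.
by rewrite val_indhomogX.
Qed.

Lemma mem_monomial_span e (s : seq 'X_{1..n.+1}) (p : dhomog n.+1 K e) :
  {subset msupp (p : R) <= s} ->
  p \in <<[seq (indhomog e 'X_[m] : dhomog n.+1 K e) | m <- s]>>%VS.
Proof.
move=> sub; rewrite [p]dhomogE_sum big_seq.
apply: memv_suml => m /sub ms; apply/memvZ/memv_span.
exact: map_f.
Qed.

Lemma graded_piece0 U e : (forall m, U m -> mdeg m <> e) ->
  graded_piece (monomial_ideal (K := K) U) e = 0%VS.
Proof.
move=> Ue; apply/eqP; rewrite -subv0; apply/subvP => p /mem_graded_monomial Up.
rewrite memv0; apply/eqP/val_inj/eqP => /=; rewrite -msupp_eq0.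
apply/eqP; case E : (msupp p) => [//|m s].
have mp : m \in msupp (p : R) by rewrite E mem_head.
by case: (Ue m (Up m mp)); exact: mdeg_msupp_dhomog mp.
Qed.

Lemma graded_monomial_span U e (s : seq 'X_{1..n.+1}) :
  uniq s -> (forall m, m \in s <-> U m /\ mdeg m = e) ->
  graded_piece (monomial_ideal (K := K) U) e
    = <<[seq (indhomog e 'X_[m] : dhomog n.+1 K e) | m <- s]>>%VS
  /\ \dim (graded_piece (monomial_ideal (K := K) U) e) = size s.
Proof.
move=> us sE.
have E : graded_piece (monomial_ideal (K := K) U) e
    = <<[seq (indhomog e 'X_[m] : dhomog n.+1 K e) | m <- s]>>%VS.
  apply/eqP; rewrite eqEsubv; apply/andP; split.
    apply/subvP => p /mem_graded_monomial Up; apply: mem_monomial_span => m mp.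
    by apply/sE; split; [exact: Up | exact: mdeg_msupp_dhomog mp].
  apply/span_subvP => _ /mapP[m /sE[Um dm] ->].
  by apply/mem_graded_monomial; rewrite val_indhomogX //; apply/monomial_idealX.
split=> //; rewrite E.
have /eqP-> : free [seq (indhomog e 'X_[m] : dhomog n.+1 K e) | m <- s].
  by apply: free_monomials => //; apply/allP => m /sE[_ ->].
by rewrite size_map.
Qed.

End HomogeneousPieces.

Section GradedI.
Variables (d j : nat).
Hypotheses (j_ge1 : (1 <= j)%N) (j_le : (4 * j <= d - 1)%N).

Lemma mdeg_gen_mnm i : (i <= d)%N -> mdeg (gen_mnm d j i) = d.
Proof.
move=> id; rewrite mdeg3 /gen_mnm.
by do ![case: ifP => ?]; rewrite !mnm3E; lia.
Qed.

Lemma gen_mnm_inj i i' : (i <= d)%N -> (i' <= d)%N ->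
  gen_mnm d j i = gen_mnm d j i' -> i = i'.
Proof.
move=> id id' /mnm3P[_]; rewrite /gen_mnm.
by do ![case: ifP => ?]; rewrite !mnm3E; lia.
Qed.

Lemma up_closed_in_genI : up_closed (in_genI d j).
Proof.
move=> m k [i id le]; exists i => //; apply: lepm_trans le _; exact: lem_addr.
Qed.

Lemma in_genI_deg_ge m : in_genI d j m -> (d <= mdeg m)%N.
Proof.
by move=> [i /mdeg_gen_mnm + /lepm3P[*]]; rewrite !mdeg3; lia.
Qed.

Definition gens : seq 'X_{1..3} := [seq gen_mnm d j i | i <- iota 0 d.+1].

(** The generators all have degree d, so in this degree divisibility by one of them is equality.
    Hence [gens] indexes a basis of [I_j]_d. *)
Lemma mem_gens m : m \in gens <-> in_genI d j m /\ mdeg m = d.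
Proof.
split=> [/mapP[i]|[[i id le] md]].
  rewrite mem_iota /= add0n ltnS => id ->.
  by split; [exists i; rewrite ?lepm_refl | exact: mdeg_gen_mnm].
apply/mapP; exists i; first by rewrite mem_iota.
move: (mdeg_gen_mnm id) md; rewrite !mdeg3.
by move/lepm3P: le => [*]; apply/mnm3P; split; lia.
Qed.

Lemma uniq_gens : uniq gens.
Proof.
rewrite map_inj_in_uniq ?iota_uniq // => i i'; rewrite !mem_iota /= !add0n !ltnS.
exact: gen_mnm_inj.
Qed.

End GradedI.

(** * Restriction to a line *)

Section Subspaces.
Variables (K : fieldType) (E : lmodType K).

(** A predicate instead of a [{vspace _}], since it is applied to the infinite-dimensional space
    [{poly K}]. *)
Definition subspace (V : E -> Prop) : Prop :=
  V 0 /\ forall c f g, V f -> V g -> V (c *: f + g).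

Variable V : E -> Prop.
Hypothesis subV : subspace V.

Lemma subspaceD f g : V f -> V g -> V (f + g).
Proof. by move=> Vf Vg; have := subV.2 1 _ _ Vf Vg; rewrite scale1r. Qed.

Lemma subspaceZ c f : V f -> V (c *: f).
Proof. by move=> Vf; have := subV.2 c _ _ Vf subV.1; rewrite addr0. Qed.

Lemma subspaceB f g : V f -> V g -> V (f - g).
Proof. by move=> Vf Vg; have := subV.2 (-1) _ _ Vg Vf; rewrite scaleN1r addrC. Qed.

Lemma subspace_sum (I : Type) (r : seq I) (P : pred I) (F : I -> E) :
  (forall i, P i -> V (F i)) -> V (\sum_(i <- r | P i) F i).
Proof.
by move=> VF; elim/big_ind: _ => //; [exact: subV.1 | exact: subspaceD].
Qed.

End Subspaces.

Section PolySubspaces.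
Variables (K : fieldType) (V : {poly K} -> Prop).
Hypothesis subV : subspace V.
Implicit Types (f g q : {poly K}).

Lemma subspace_poly N f :
  (forall i, (i < N)%N -> V 'X^i) -> (size f <= N)%N -> V f.
Proof.
move=> VX sf; rewrite -[f]coefK poly_def; apply: (subspace_sum subV) => i _.
by apply: (subspaceZ subV); apply: VX; exact: leq_trans sf.
Qed.

Lemma subspace_mulp M q g :
  (forall a, (a < M)%N -> V ('X^a * q)) -> (size g <= M)%N -> V (g * q).
Proof.
move=> VM sg; pose W f := V (f * q); have subW : subspace W.
  split; first by rewrite /W mul0r; exact: subV.1.
  by move=> c f h Wf Wh; rewrite /W mulrDl -scalerAl; exact: subV.2.
rewrite -/(W g) -[g]coefK poly_def; apply: (subspace_sum subW) => i _.
by apply: (subspaceZ subW); apply: VM; exact: leq_trans sg.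
Qed.

Let size_exp1X N : size ((1 + 'X : {poly K}) ^+ N) = N.+1.
Proof.
by rewrite (_ : 1 + 'X = 'X - (-1)%:P) ?size_exp_XsubC // polyCN opprK addrC.
Qed.

(** Euclidean division by (1 + X)^(N+1): the quotient has size at most [M] and the remainder size at
    most [N + 1]. *)
Lemma subspace_divp N M f :
  (forall i, (i <= N)%N -> V 'X^i) ->
  (forall a, (a < M)%N -> V ('X^a * (1 + 'X) ^+ N.+1)) ->
  (size f <= N.+1 + M)%N -> V f.
Proof.
move=> VN VM sf; pose q : {poly K} := (1 + 'X) ^+ N.+1.
have sq : size q = N.+2 by rewrite size_exp1X.
have q0 : q != 0 by rewrite -size_poly_eq0 sq.
rewrite (divp_eq f q); apply: (subspaceD subV).
  by apply: (@subspace_mulp M) => //; rewrite size_divp // sq leq_subLR.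
by apply: (@subspace_poly N.+1) => //; rewrite -ltnS -sq ltn_modp.
Qed.

(** Since 1 = (1 + X) - X, a product of total degree below [N] is a difference of two products of
    the next degree; induction on N - (a + b). *)
Lemma subspace_binomial_step M N :
  (forall i, (M <= i <= N)%N -> V ('X^(N - i) * (1 + 'X) ^+ i)) ->
  forall a b, (M <= b)%N -> (a + b <= N)%N -> V ('X^a * (1 + 'X) ^+ b).
Proof.
move=> VN a b; have [k] := ubnP (N - (a + b)).
elim: k a b => // k IH a b lt_k Mb abN.
have [E|ne] := eqVneq (a + b)%N N.
  by have := VN b; rewrite -E addnK; apply; rewrite Mb leq_addl.
rewrite (_ : 'X^a * _ = 'X^a * (1 + 'X) ^+ b.+1 - 'X^(a.+1) * (1 + 'X) ^+ b).
  by apply: (subspaceB subV); apply: IH; lia.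
rewrite !exprS; ring.
Qed.

Hypothesis charK : [pchar K] =i pred0.

(* The remainder of X^d modulo (1 + X)^(N+1) has a nonzero coefficient at X^N:
   after X := X - 1 this coefficient is, up to sign, a binomial coefficient. *)
Lemma subspace_pow N M d :
  (N <= d)%N -> (d <= N + M)%N ->
  (forall i, (i < N)%N -> V 'X^i) ->
  (forall a, (a < M)%N -> V ('X^a * (1 + 'X) ^+ N.+1)) ->
  V 'X^d -> V 'X^N.
Proof.
move=> Nd dM VN VM Vd; pose q : {poly K} := (1 + 'X) ^+ N.+1.
have sq : size q = N.+2 by rewrite size_exp1X.
have q0 : q != 0 by rewrite -size_poly_eq0 sq.
pose r := 'X^d %% q; have sr : (size r <= N.+1)%N by rewrite -ltnS -sq ltn_modp.
have Vr : V r.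
  rewrite (_ : r = 'X^d - 'X^d %/ q * q); last first.
    by apply/esym/eqP; rewrite subr_eq addrC -divp_eq.
  apply: (subspaceB subV) => //; apply: (@subspace_mulp M) => //.
  by rewrite size_divp // size_polyXn sq; move: dM; clear; lia.
(* If this coefficient vanished, [r] and its composite with X - 1 would have degree below [N], while
   (1 + X)^(N+1) becomes X^(N+1); the coefficient of (X - 1)^d at X^N would then be 0. *)
have rN : r`_N != 0.
  apply/eqP => rN0; have {}sr : (size r <= N)%N.
    apply/leq_sizeP => i; rewrite leq_eqVlt => /orP[/eqP<- //|ltNi].
    by move/leq_sizeP: sr; apply.
  have /(congr1 (fun f : {poly K} => (f \Po ('X - 1))`_N)) := divp_eq 'X^d q.
  rewrite -/r comp_polyD comp_polyM coefD comp_Xn_poly.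
  have -> : q \Po ('X - 1) = 'X^(N.+1).
    rewrite /q rmorphXn /= comp_polyD comp_polyX -['X^(N.+1)]/('X ^+ N.+1).
    by congr (_ ^+ _); rewrite -polyC1 comp_polyC polyC1 addrC subrK.
  rewrite coefMXn ltnSn add0r.
  have -> : (r \Po ('X - 1))`_N = 0.
    apply/nth_default; rewrite size_comp_poly2 //.
    by rewrite -polyC1 size_XsubC.
  have ltd : (d - N < d.+1)%N by rewrite ltnS leq_subr.
  rewrite exprBn coef_sum (bigD1 (Ordinal ltd)) //=.
  have sgn k : (-1 : {poly K}) ^+ k = ((-1) ^+ k)%:P by rewrite rmorphXn rmorphN1.
  rewrite big1 => [|[i lti] /= ne].
    rewrite expr1n mulr1 subKn // coefMn sgn coefCM coefXn eqxx mulr1 !addr0.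
    move/eqP; rewrite -mulr_natr mulf_eq0 signr_eq0 /= ((pcharf0P K).1 charK).
    by rewrite bin_sub // eqn0Ngt bin_gt0 Nd.
  rewrite expr1n mulr1 coefMn sgn coefCM coefXn.
  case: eqP => [NE|]; last by rewrite mulr0 mul0rn.
  by case/eqP: ne; apply/val_inj => /=; move: NE lti; clear; lia.
have VrN : V (r - r`_N *: 'X^N).
  apply: (@subspace_poly N) => //; apply/leq_sizeP => i.
  rewrite coefB coefZ coefXn leq_eqVlt => /orP[/eqP<-|ltNi].
    by rewrite eqxx mulr1 subrr.
  by rewrite gtn_eqF // mulr0 subr0; move/leq_sizeP: sr; apply.
rewrite (_ : 'X^N = (r`_N)^-1 *: (r - (r - r`_N *: 'X^N))).
  by apply: (subspaceZ subV); apply: (subspaceB subV).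
by rewrite opprB addrC subrK scalerA mulVf ?scale1r.
Qed.

End PolySubspaces.

HB.instance Definition _ (K : fieldType) n i (l : dhomog n.+1 K 1) :=
  GRing.isLinear.Build K (dhomog n.+1 K i) (dhomog n.+1 K i.+1) _
    (@mul_form K n i l) (@mul_form_is_linear K n i l).

Section MulForm.
Variables (K : fieldType) (n : nat) (l : dhomog n.+1 K 1).
Hypothesis l0 : l != 0.

Lemma limg_mul_formP i q :
  q \in limg (linfun (@mul_form K n i l)) <-> exists p, q = mul_form l p.
Proof.
split=> [/memv_imgP[p _ ->]|[p ->]]; first by exists p; rewrite lfunE.
by rewrite -(lfunE (@mul_form K n i l)) memv_img ?memvf.
Qed.

Lemma mul_form_inj i : injective (@mul_form K n i l).
Proof.
move=> p q /(congr1 (@mpoly_of_dhomog _ _ _)) /= /mulfI E; apply/val_inj/E.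
by apply: contraNneq l0 => lE; apply/eqP/val_inj.
Qed.

Lemma dim_limg_mul_form i :
  \dim (limg (linfun (@mul_form K n i l))) = 'C(i + n, i).
Proof.
rewrite -(dim_dhomog K) limg_dim_eq //; apply/eqP; rewrite capfv -subv0.
apply/subvP => p; rewrite memv_ker lfunE /= memv0 => /eqP E.
by apply/eqP/(@mul_form_inj i); rewrite E linear0.
Qed.

End MulForm.

Section OnLine.
Variables (K : fieldType) (a : 'I_3 -> K).
Hypothesis a_neq0 : forall i, a i != 0.

Definition line_var (i : 'I_3) : {poly K} :=
  nth 0 [:: (a 0)^-1%:P; (a 1)^-1 *: 'X; - (a 2)^-1 *: (1 + 'X)] i.

(* Parametrisation of the line [a 0 x + a 1 y + a 2 z = 0] by [1 : t : -(1 + t)]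
   up to rescaling the coordinates. *)
Definition on_line : {mpoly K[3]} -> {poly K} := mmap polyC line_var.
HB.instance Definition _ := GRing.RMorphism.on on_line.

Definition line_coef (m : 'X_{1..3}) : K :=
  (a 0)^-1 ^+ m 0 * (a 1)^-1 ^+ m 1 * (- (a 2)^-1) ^+ m 2.

Definition line_poly (m : 'X_{1..3}) : {poly K} := 'X^(m 1) * (1 + 'X) ^+ m 2.

Lemma line_coef_neq0 m : line_coef m != 0.
Proof. by rewrite !mulf_neq0 // expf_neq0 ?oppr_eq0 ?invr_neq0. Qed.

Lemma on_lineZ c p : on_line (c *: p) = c *: on_line p.
Proof. by rewrite /on_line mmapZ mul_polyC. Qed.

Lemma on_lineX m : on_line 'X_[m] = line_coef m *: line_poly m.
Proof.
rewrite /on_line mmapX /mmap1 !big_ord_recr big_ord0 /= mul1r.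
rewrite (_ : widen_ord _ _ = 0); last exact/val_inj.
rewrite (_ : widen_ord _ _ = 1); last exact/val_inj.
rewrite (_ : ord_max = 2); last exact/val_inj.
rewrite /line_var /= !exprZn -rmorphXn /= -!mul_polyC /line_coef /line_poly.
rewrite !rmorphM /=; ring.
Qed.

Lemma on_line_form (l : dhomog 3 K 1) :
  (forall i, (l : {mpoly K[3]})@_U_(i) = a i) -> on_line l = 0.
Proof.
move=> la.
have -> : (l : {mpoly K[3]}) = a 0 *: 'X_0 + a 1 *: 'X_1 + a 2 *: 'X_2.
  apply/mpolyP => m; rewrite !mcoeffD !mcoeffZ.
  have [md|md] := eqVneq (mdeg m) 1%N.
    move/eqP/mdeg1P: md => [i /eqP->].
    rewrite la !mcoeffXU; move: i; apply/forall_ord3.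
    by rewrite !(mulr0, mulr1, addr0, add0r).
  rewrite (dhomog_nemf_coeff (dhomog_is_dhomog l)) // !mcoeffX.
  have E i : (U_(i)%MM == m) = false.
    by apply: contraNF md => /eqP<-; rewrite mdeg1.
  by rewrite !E !mulr0 !addr0.
rewrite !raddfD /= !on_lineZ !on_lineX /line_coef /line_poly.
rewrite !mnm1E /= !expr0 !expr1 !mulr1 !mul1r !scalerA !mulrN !divff //.
by rewrite !scale1r scaleN1r subrr.
Qed.

Lemma size_on_line e (p : dhomog 3 K e) : (size (on_line p) <= e.+1)%N.
Proof.
rewrite [p]dhomogE_sum raddf_sum /= raddf_sum /= big_seq.
apply: (big_ind (fun f : {poly K} => (size f <= e.+1)%N)); first by rewrite size_poly0.
  by move=> f g sf sg; rewrite (leq_trans (size_polyD _ _)) // geq_max sf.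
move=> m /mdeg_msupp_dhomog md; rewrite on_lineZ val_indhomogX //.
apply: leq_trans (size_scale_leq _ _) _; rewrite on_lineX.
apply: leq_trans (size_scale_leq _ _) _; rewrite /line_poly.
apply: leq_trans (size_polyMleq _ _) _; rewrite size_polyXn.
rewrite (_ : 1 + 'X = 'X - (-1)%:P) ?size_exp_XsubC; last by rewrite polyCN opprK addrC.
by move: md; rewrite mdeg3; lia.
Qed.

Definition line_row e (p : dhomog 3 K e) : 'rV[K]_e.+1 := poly_rV (on_line p).

Lemma line_row_is_linear e : linear (@line_row e).
Proof.
by move=> c p q; rewrite /line_row raddfD /= on_lineZ linearP.
Qed.
HB.instance Definition _ e := GRing.isLinear.Build K (dhomog 3 K e) 'rV[K]_e.+1 _
  (@line_row e) (@line_row_is_linear e).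

Lemma line_row_eq0 e (p : dhomog 3 K e) : line_row p = 0 <-> on_line p = 0.
Proof.
split=> [E|E]; last by rewrite /line_row E linear0.
by rewrite -(@poly_rV_K _ e.+1 (on_line p)) ?size_on_line // -/(line_row p) E linear0.
Qed.

Lemma on_line_surj e (f : {poly K}) : (size f <= e.+1)%N ->
  exists p : dhomog 3 K e, on_line p = f.
Proof.
(* Monomials in x and y alone suffice: x^(e-i) y^i restricts to a scalar multiple of X^i. *)
move=> sf; exists (\sum_(i < e.+1) (f`_i / line_coef (mnm3 (e - i) i 0)) *:
   (indhomog e 'X_[mnm3 (e - i) i 0] : dhomog 3 K e)).
rewrite raddf_sum /= raddf_sum /=; under eq_bigr => i _.
  rewrite on_lineZ val_indhomogX ?mdeg3 ?mnm3E ?addn0 ?subnK -1?ltnS //.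
  rewrite on_lineX scalerA divfK ?line_coef_neq0 // /line_poly !mnm3E expr0 mulr1.
  over.
rewrite -(poly_def e.+1 (fun i => f`_i)); apply/polyP => k; rewrite coef_poly.
by case: ltnP => // le; rewrite nth_default // (leq_trans sf).
Qed.

Variable l : dhomog 3 K 1.
Hypothesis la : forall i, (l : {mpoly K[3]})@_U_(i) = a i.

Let l_neq0 : l != 0.
Proof. by apply: contraNneq (a_neq0 0) => l0; rewrite -la l0 mcoeff0. Qed.

(** Multiples of [l] restrict to 0; equality follows from surjectivity of the restriction and C(e+3,
    e+1) - (e+2) = C(e+2, e). *)
Lemma lker_line_row e :
  lker (linfun (@line_row e.+1)) = limg (linfun (@mul_form K 2 e l)).
Proof.
apply/esym/eqP; rewrite eqEdim; apply/andP; split.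
  apply/subvP => _ /limg_mul_formP[p ->]; rewrite memv_ker lfunE /=.
  by apply/eqP/line_row_eq0; rewrite /= rmorphM /= on_line_form // mul0r.
rewrite dim_limg_mul_form //.
have := limg_ker_dim (linfun (@line_row e.+1)) fullv.
have -> : limg (linfun (@line_row e.+1)) = fullv.
  apply/eqP; rewrite eqEsubv subvf /=; apply/subvP => v _.
  have [p pE] := @on_line_surj e.+1 (rVpoly v) (size_poly _ _).
  apply/memv_imgP; exists p; rewrite ?memvf // lfunE /= /line_row pE.
  by rewrite rVpolyK.
rewrite capfv dim_dhomog dimvf /dim /= mul1n.
rewrite addSn binS addn2 binSn addnC => /eqP; rewrite eqn_add2l => /eqP E.
by rewrite E.
Qed.

Lemma on_line_eq0 e (p : dhomog 3 K e.+1) :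
  on_line p = 0 <-> exists q, p = mul_form l q.
Proof.
rewrite -line_row_eq0 -limg_mul_formP -lker_line_row memv_ker lfunE /=.
by split=> /eqP.
Qed.

End OnLine.

(** * The restriction of I_j to the line *)

Section LineImage.
Variables (K : fieldType) (charK : [pchar K] =i pred0).
Variables (d j : nat).
Hypotheses (j_ge1 : (1 <= j)%N) (j_le : (4 * j <= d - 1)%N).
Variables (a : 'I_3 -> K) (l : dhomog 3 K 1).
Hypothesis a_neq0 : forall i, a i != 0.
Hypothesis la : forall i, (l : {mpoly K[3]})@_U_(i) = a i.

Local Notation U := (in_genI d j).
Local Notation I := (monomial_ideal (K := K) U).

Definition line_image e (f : {poly K}) : Prop :=
  exists2 g : dhomog 3 K e, I g & on_line a g = f.

Lemma subspace_line_image e : subspace (line_image e).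
Proof.
split; first by exists 0; [exact: monomial_ideal0 | rewrite raddf0].
move=> c _ _ [g Ig <-] [h Ih <-]; exists (c *: g + h).
  by apply: monomial_idealD => //; exact: monomial_idealZ.
by rewrite -on_lineZ -raddfD.
Qed.

Lemma line_imageX e m : U m -> mdeg m = e -> line_image e (line_poly K m).
Proof.
move=> Um md; rewrite -(scale1r (line_poly K m)) -(mulVf (line_coef_neq0 a_neq0 m)).
rewrite -scalerA; apply: (subspaceZ (subspace_line_image e)).
exists (indhomog e 'X_[m]); rewrite val_indhomogX // ?on_lineX //.
exact/monomial_idealX.
Qed.

(** On the line x is a nonzero constant and y a nonzero multiple of X, and I_j is closed under
    multiplication by both. *)
Lemma line_imageS e f :
  line_image e f -> line_image e.+1 f /\ line_image e.+1 ('X * f).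
Proof.
move=> [g Ig <-].
have dX i : mdeg U_(i)%MM = 1%N :> nat by exact: mdeg1.
have IX (i : 'I_3) : line_image e.+1 (line_poly K U_(i) * on_line a g).
  rewrite -(scale1r (line_poly K _)) -(mulVf (line_coef_neq0 a_neq0 U_(i)%MM)).
  rewrite -scalerA -scalerAl; apply: (subspaceZ (subspace_line_image _)).
  exists (mul_form (indhomog 1 'X_i) g) => /=.
    by rewrite mulrC; apply: monomial_idealM => //; exact: up_closed_in_genI.
  by rewrite rmorphM /= val_indhomogX ?dX // on_lineX.
split; first by have := IX 0; rewrite /line_poly !mnm1E /= !expr0 !mul1r.
by have := IX 1; rewrite /line_poly !mnm1E /= expr0 mulr1 expr1.
Qed.

Lemma line_image_gen i : (i <= d)%N -> line_image d (line_poly K (gen_mnm d j i)).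
Proof.
move=> id; apply: line_imageX; last exact: mdeg_gen_mnm.
by exists i; rewrite ?lepm_refl.
Qed.

Lemma line_poly_block k r : (k < j)%N -> (r < 4)%N ->
  line_poly K (gen_mnm d j (4 * k + r)) =
   nth 0 [:: 'X^(4 * k); 'X^(4 * k + 1) * (1 + 'X);
             'X^(4 * k) * (1 + 'X) ^+ 3; 'X^(4 * k + 3)] r.
Proof.
move=> kj r4; rewrite gen_mnm_blockP //.
by case: r r4 => [|[|[|[|//]]]] _ /=; rewrite /line_poly !mnm3E ?mulr1 ?expr1.
Qed.

Lemma line_poly_tail i : (4 * j <= i)%N -> line_poly K (gen_mnm d j i) =
   if i == (4 * j)%N then 'X^d else 'X^(d - i) * (1 + 'X) ^+ i.
Proof.
move=> ij; rewrite /gen_mnm ifN; last by rewrite -leqNgt.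
by case: eqP => _; rewrite /line_poly !mnm3E ?expr0 ?mulr1.
Qed.

Lemma line_image_block k : (k < j)%N ->
  [/\ line_image d 'X^(4 * k), line_image d ('X^(4 * k + 1) * (1 + 'X))
    & line_image d 'X^(4 * k + 3)].
Proof.
move=> kj; have G r : (r < 4)%N -> line_image d (line_poly K (gen_mnm d j (4 * k + r))).
  by move=> r4; apply: line_image_gen; lia.
split.
- by have := G 0%N isT; rewrite line_poly_block.
- by have := G 1%N isT; rewrite line_poly_block.
- by have := G 3%N isT; rewrite line_poly_block.
Qed.

Lemma line_imageXd : line_image d 'X^d.
Proof.
have := @line_image_gen (4 * j); rewrite line_poly_tail // eqxx; apply; lia.
Qed.

(** The generators y^(d-i) z^i with i > 4j give the products of total degree exactly d;
    [subspace_binomial_step] supplies the lower ones. *)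
Lemma line_image_tail b c : (4 * j < c)%N -> (b + c <= d)%N ->
  line_image d ('X^b * (1 + 'X) ^+ c).
Proof.
apply: (subspace_binomial_step (subspace_line_image d)) => i /andP[ij id].
by have := line_image_gen id; rewrite line_poly_tail ?gtn_eqF // ltnW.
Qed.

Lemma line_image_full e (f : {poly K}) : (d < e)%N -> (size f <= e.+1)%N -> line_image e f.
Proof.
elim: e f => // e IH f; rewrite ltnS leq_eqVlt => /orP[/eqP<-|lt_de] sf; last first.
  have sub := subspace_line_image e.+1.
  have XE i : (i < e.+2)%N -> line_image e.+1 'X^i.
    case: i => [|i] ie; first by have [] := @line_imageS e 1 (IH _ lt_de _);
      rewrite ?size_poly1.
    rewrite exprS; apply: (@line_imageS e 'X^i _).2.
    by apply: IH; rewrite // size_polyXn.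
  exact: subspace_poly XE sf.
have sub := subspace_line_image d.+1.
(* In degree d + 1 it suffices to reach X^0, ..., X^(4j) and the products X^b (1 + X)^(4j+1) with b
   <= d - 4j. *)
apply: (@subspace_divp _ _ sub (4 * j) (d - 4 * j).+1); last by lia.
  (* Multiplying block [k] by x and y gives five consecutive powers; the value r = 4 in the last
     block is what reaches X^(4j). *)
  have B k : (k < j)%N -> forall r, (r <= 4)%N -> line_image d.+1 'X^(4 * k + r).
    move=> kj; have [] := line_image_block kj.
    move=> /line_imageS[B0]; rewrite -exprS => B1 /line_imageS[B12 _].
    move=> /line_imageS[B3]; rewrite -exprS => B4.
    case=> [|[|[|[|[|//]]]]] _; rewrite ?addn0 //.
    - by rewrite addn1.
    - rewrite (_ : 'X^(4 * k + 2) = 'X^(4 * k + 1) * (1 + 'X) - 'X^((4 * k).+1)).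
        exact: (subspaceB sub).
      by rewrite mulrDr mulr1 -exprSr addrAC addn1 subrr add0r addn2.
    - by rewrite addnS.
  move=> i; rewrite leq_eqVlt => /orP[/eqP->|ij].
    by rewrite (_ : (4 * j = 4 * (j - 1) + 4)%N); [apply: B => //; lia | lia].
  by rewrite (_ : (i = 4 * (i %/ 4) + i %% 4)%N); [apply: B; lia | lia].
case=> [|b] lt_b.
  by apply: (line_imageS _).1; apply: line_image_tail; lia.
by rewrite exprS -mulrA; apply: (line_imageS _).2; apply: line_image_tail; lia.
Qed.

(** By [line_image_full] some form of I_j has the same restriction as [q]; the difference vanishes
    on the line, so it is a multiple of [l]. *)
Lemma mul_surjective_genI i : (d < i.+1)%N -> mul_surjective I i l.
Proof.
move=> di q; have [g Ig gq] := line_image_full di (size_on_line a q).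
have [p pE] : exists p, q - g = mul_form l p.
  by apply/(on_line_eq0 a_neq0 la); rewrite raddfB /= gq subrr.
exists p; rewrite (_ : _ - _ = g :> {mpoly K[3]}) //.
by move/(congr1 (@mpoly_of_dhomog _ _ _)): pE => /= <-; rewrite opprB addrC subrK.
Qed.

(** The degree is a variable [e] with an equation, so that [dim_add_graded] can use [e.+1] without
    transport between dependent types. *)
Lemma dim_line_row_genI e : e = d ->
  \dim (linfun (@line_row K a e) @: graded_piece I e) = (d.+1 - j)%N.
Proof.
move=> ed; set G := graded_piece I e; set r := linfun _.
have [GE _] : G = <<[seq (indhomog e 'X_[m] : dhomog 3 K e) | m <- gens d j]>>%VS
   /\ \dim G = size (gens d j).
  apply: graded_monomial_span; first exact: uniq_gens.
  by move=> m; rewrite ed; exact: mem_gens.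
have rP (f : {poly K}) : line_image d f -> poly_rV f \in (r @: G)%VS.
  rewrite -ed => -[g Ig <-]; apply/memv_imgP; exists g; last by rewrite lfunE.
  exact/mem_graded_monomial.
apply/eqP; rewrite eqn_leq; apply/andP; split.
  pose P (s : seq {poly K}) := [seq (poly_rV f : 'rV[K]_e.+1) | f <- s].
  pose L := [seq 'X^(4 * k) : {poly K} | k <- iota 0 j]
         ++ [seq 'X^(4 * k + 1) * (1 + 'X) | k <- iota 0 j]
         ++ [seq 'X^(4 * k + 3) : {poly K} | k <- iota 0 j]
         ++ [seq line_poly K (gen_mnm d j i) | i <- iota (4 * j) (d.+1 - 4 * j)].
  have sL : size (P L) = (d.+1 - j)%N.
    by rewrite size_map !size_cat !size_map !size_iota; lia.
  rewrite -sL; apply: leq_trans (dim_span _); apply: dimvS.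
  rewrite GE limg_span; apply/span_subvP => _ /mapP[_ /mapP[m /mapP[i + ->] ->] ->].
  rewrite mem_iota add0n ltnS => /andP[_ id].
  rewrite lfunE /= /line_row val_indhomogX; last by rewrite mdeg_gen_mnm.
  rewrite on_lineX linearZ; apply: memvZ.
  have LP f : f \in L -> (poly_rV f : 'rV[K]_e.+1) \in <<P L>>%VS.
    by move=> fL; apply: memv_span; exact: map_f.
  case: (ltnP i (4 * j)) => ij; last first.
    apply: LP; rewrite !mem_cat; apply/or4P; constructor 4.
    by apply: map_f; rewrite mem_iota; lia.
  pose k := (i %/ 4)%N; have kj : (k < j)%N by lia.
  have ki : k \in iota 0 j by rewrite mem_iota.
  have L0 : 'X^(4 * k) \in L.
    by rewrite !mem_cat; apply/or4P; constructor 1; exact: (map_f (fun k => 'X^(4 * k))).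
  have L1 : 'X^(4 * k + 1) * (1 + 'X) \in L.
    rewrite !mem_cat; apply/or4P; constructor 2.
    exact: (map_f (fun k => 'X^(4 * k + 1) * (1 + 'X))).
  have L3 : 'X^(4 * k + 3) \in L.
    by rewrite !mem_cat; apply/or4P; constructor 3; exact: (map_f (fun k => 'X^(4 * k + 3))).
  have r4 : (i %% 4 < 4)%N by lia.
  rewrite (_ : i = (4 * k + i %% 4)%N); last by lia.
  rewrite line_poly_block //; case: (i %% 4)%N r4 => [|[|[|[|//]]]] _; try exact: LP.
  (* The Togliatti relation on the line: (1 + X)^3 = 1 + 3 X (1 + X) + X^3. *)
  rewrite (_ : nth _ _ _ = 'X^(4 * k) + 3 *: ('X^(4 * k + 1) * (1 + 'X)) + 'X^(4 * k + 3)).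
    by rewrite !linearD linearZ /= !memvD ?memvZ ?LP.
  rewrite /= -mul_polyC polyC_natr !exprD expr1; ring.
(* Lower bound: adjoining [S], of dimension at most j, yields the whole space, so the image has
   dimension at least d + 1 - j. *)
pose S := <<[seq (poly_rV 'X^(4 * k + 1) : 'rV[K]_e.+1) | k <- iota 0 j]>>%VS.
have dS : (\dim S <= j)%N by rewrite (leq_trans (dim_span _)) // size_map size_iota.
suff : (d.+1 <= \dim (r @: G + S))%N.
  by move/leq_trans/(_ (dimv_add_leqif _ _)) => H; move: H dS; clear; lia.
have <- : \dim (fullv : {vspace 'rV[K]_e.+1}) = d.+1 by rewrite dimvf /dim /= mul1n ed.
apply: dimvS.
pose V (f : {poly K}) := (poly_rV f : 'rV[K]_e.+1) \in (r @: G + S)%VS.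
have subV : subspace V.
  split; first by rewrite /V linear0 mem0v.
  by move=> c f g Vf Vg; rewrite /V linearP memvD // memvZ.
have GV f : line_image d f -> V f by move/rP; apply: (subvP (addvSl _ _)).
have V1 k : (k < j)%N -> V 'X^(4 * k + 1).
  move=> kj; apply: (subvP (addvSr _ _)); apply: memv_span.
  by apply: (map_f (fun k => poly_rV 'X^(4 * k + 1))); rewrite mem_iota.
have VX i : (i < 4 * j)%N -> V 'X^i.
  move=> ij; have kj : (i %/ 4 < j)%N by lia.
  have [B0 B12 B3] := line_image_block kj.
  rewrite (_ : i = (4 * (i %/ 4) + i %% 4)%N); last by lia.
  have r4 : (i %% 4 < 4)%N by lia.
  case: (i %% 4)%N r4 => [|[|[|[|//]]]] _; rewrite ?addn0; try exact: GV; try exact: V1.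
  rewrite (_ : 'X^_ = 'X^(4 * (i %/ 4) + 1) * (1 + 'X) - 'X^(4 * (i %/ 4) + 1)).
    by apply: (subspaceB subV); [exact: GV | exact: V1].
  by rewrite mulrDr mulr1 -exprSr addrAC subrr add0r addn2 addn1.
have VT b : (b < d - 4 * j)%N -> V ('X^b * (1 + 'X) ^+ (4 * j).+1).
  by move=> ltb; apply: GV; apply: line_image_tail; lia.
(* The one power up to 4j not supplied by the blocks; it comes from the generator y^d. *)
have V4j : V 'X^(4 * j).
  apply: (subspace_pow subV charK (M := (d - 4 * j)%N) (d := d)) => //; try lia.
  exact/GV/line_imageXd.
apply/subvP => v _; rewrite -[v]rVpolyK.
apply: (@subspace_divp _ _ subV (4 * j) (d - 4 * j)) => //.
  by move=> i; rewrite leq_eqVlt => /orP[/eqP->|/VX].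
by rewrite (leq_trans (size_poly _ _)) // ed; lia.
Qed.

(** Rank-nullity for the restriction on l[R]_e + [I_j]_d: the kernel is l[R]_e and the image is that
    of [I_j]_d. *)
Lemma dim_add_graded e : e.+1 = d ->
  \dim (limg (linfun (@mul_form K 2 e l)) + graded_piece I e.+1)
  = ('C(e + 2, e) + (d.+1 - j))%N.
Proof.
move=> ed; set L := limg _; set G := graded_piece _ _.
have LE : lker (linfun (@line_row K a e.+1)) = L by exact: lker_line_row.
have := limg_ker_dim (linfun (@line_row K a e.+1)) (L + G).
have -> : (linfun (@line_row K a e.+1) @: (L + G)
           = linfun (@line_row K a e.+1) @: G)%VS.
  rewrite limgD (_ : _ @: L = 0)%VS ?add0v //.
  by apply/eqP; rewrite -lkerE LE.
rewrite LE capvC (capv_idPl (addvSl L G)) dim_line_row_genI // => <-.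
rewrite dim_limg_mul_form //.
by apply: contraNneq (a_neq0 0) => l0; rewrite -la l0 mcoeff0.
Qed.

End LineImage.

(** * Lefschetz properties *)

Lemma general_form_coefs (K : fieldType) (P : dhomog 3 K 1 -> Prop) :
  (forall l : dhomog 3 K 1, (forall i, (l : {mpoly K[3]})@_U_(i) != 0) -> P l) -> general_form P.
Proof.
move=> HP; exists ('X_[mnm3 1 1 1]); first by rewrite -msupp_eq0 msuppX.
move=> l; rewrite mevalX => /prodf_neq0 H; apply: HP => i.
move: (H i isT); rewrite expf_eq0 negb_and => /orP[|//].
by move: i {H}; apply/forall_ord3; rewrite !mnm3E.
Qed.

Section Lefschetz.
Variables (K : fieldType) (charK : [pchar K] =i pred0).
Variables (d j : nat).
Hypotheses (j_ge1 : (1 <= j)%N) (j_le : (4 * j <= d - 1)%N).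
Variable (l : dhomog 3 K 1).
Hypothesis l_neq0 : forall i, (l : {mpoly K[3]})@_U_(i) != 0.

Local Notation I := (monomial_ideal (K := K) (in_genI d j)).

Let form_neq0 : l != 0.
Proof. by apply: contraNneq (l_neq0 0) => ->; rewrite mcoeff0. Qed.

Lemma mul_injective_genI i : (i.+1 < d)%N -> mul_injective I i l.
Proof.
move=> lt_id p Ip; have : mul_form l p \in graded_piece I i.+1.
  exact/mem_graded_monomial.
rewrite graded_piece0 => [|m /in_genI_deg_ge]; last by move=> /(_ j_ge1 j_le); lia.
rewrite memv0 => /eqP E; have -> : p = 0; last exact: monomial_ideal0.
by apply: (mul_form_inj form_neq0); rewrite E linear0.
Qed.

Lemma graded_piece_lt e : (e < d)%N -> graded_piece I e = 0%VS.
Proof.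
move=> ed; apply: graded_piece0 => m /in_genI_deg_ge => /(_ j_ge1 j_le); lia.
Qed.

Lemma mul_rank_lt i : (i.+1 < d)%N ->
  (mul_rank I i l + 0 = minn (hilbert I i) (hilbert I i.+1))%N.
Proof.
move=> lt_id; rewrite /mul_rank /hilbert !graded_piece_lt //; last exact: ltnW.
rewrite addv0 !dimv0 !subn0 addn0 dim_limg_mul_form // !dim_dhomog.
by apply/esym/minn_idPl; rewrite addSn binS leq_addl.
Qed.

(** Surjectivity makes the rank equal to the Hilbert function at i + 1. This is the minimum because
    multiplication by [l] embeds [I]_i into the intersection of l[R]_i and [I]_(i+1). *)
Lemma mul_rank_gt i : (d < i.+1)%N ->
  (mul_rank I i l + 0 = minn (hilbert I i) (hilbert I i.+1))%N.
Proof.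
move=> lt_di; rewrite /mul_rank /hilbert addn0; set L := limg _.
set G := graded_piece I i; set G1 := graded_piece I i.+1.
have full : (L + G1 = fullv)%VS.
  apply/eqP; rewrite eqEsubv subvf; apply/subvP => q _.
  have [p Ip] := mul_surjective_genI j_ge1 j_le l_neq0 (fun i => erefl) lt_di q.
  rewrite -(subrK (mul_form l p) q) addrC; apply: memv_add.
    by apply/limg_mul_formP; exists p.
  exact/mem_graded_monomial.
rewrite full; apply/esym/minn_idPr.
have GL : (\dim G <= \dim (L :&: G1))%N.
  rewrite -(@limg_dim_eq _ _ _ (linfun (@mul_form K 2 i l)) G).
    apply: dimvS; apply/subvP => _ /memv_imgP[p /mem_graded_monomial Ip ->].
    rewrite memv_cap memv_img ?memvf //; apply/mem_graded_monomial.
    rewrite lfunE /= mulrC; apply: monomial_idealM => //; exact: up_closed_in_genI.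
  apply/eqP; rewrite -subv0; apply/subvP => p; rewrite memv_cap memv_ker lfunE memv0.
  by move=> /andP[_ /eqP E]; apply/eqP/(mul_form_inj form_neq0); rewrite E linear0.
have := dimv_sum_cap L G1; rewrite full {2}/L dim_limg_mul_form // -(dim_dhomog K).
have arith (f1 f0 c g g1 : nat) : (g <= c)%N -> (g <= f0)%N -> (g1 <= f1)%N ->
  (f1 + c = f0 + g1)%N -> (f1 - g1 <= f0 - g)%N by lia.
exact: arith GL (dimvS (subvf G)) (dimvS (subvf G1)).
Qed.

Lemma dim_graded_genI : \dim (graded_piece I d) = d.+1.
Proof.
rewrite -[RHS](size_iota 0) -(size_map (gen_mnm d j)) -/(gens d j).
apply: (graded_monomial_span _ _ _).2; first exact: uniq_gens.
exact: mem_gens.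
Qed.

Lemma mul_rank_eq i : i.+1 = d -> (mul_rank I i l + j = 'C(d.+1, 2))%N.
Proof.
move=> id; rewrite /mul_rank (dim_add_graded charK j_ge1 j_le l_neq0 (fun i => erefl)) //.
have -> : \dim (graded_piece I i.+1) = d.+1 by rewrite id dim_graded_genI.
have <- : ('C(i + 2, i) = 'C(d.+1, 2))%N.
  by rewrite -(@bin_sub (i + 2) i) ?leq_addr // addKn -id addn2.
(* Since j <= i, this bound keeps the truncated subtraction exact. *)
have : (i <= 'C(i + 2, i))%N.
  by rewrite -(@bin_sub (i + 2) i) ?leq_addr // addKn addn2 bin2 /= mulnS; lia.
by move: j_le id; clear; lia.
Qed.

(** Both Hilbert function values are C(d+1, 2): below degree d the ideal is zero, and in degree d
    one has C(d+2, 2) - (d+1) = C(d+1, 2). *)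
Lemma fails_WLP_genI i : i.+1 = d ->
  (mul_rank I i l + j = minn (hilbert I i) (hilbert I i.+1))%N.
Proof.
move=> id; rewrite mul_rank_eq // /hilbert.
have -> : \dim (graded_piece I i.+1) = d.+1 by rewrite id dim_graded_genI.
rewrite graded_piece_lt ?dimv0 ?subn0 ?dim_dhomog; last by rewrite -id.
rewrite (_ : 'C(i.+1 + 2, i.+1) - d.+1 = 'C(i + 2, i))%N.
  by rewrite minnn -(@bin_sub (i + 2) i) ?leq_addr // addKn -id addn2.
by rewrite addSn binS addn2 binSn id addKn.
Qed.

End Lefschetz.

Section Statements12.
Variables (K : fieldType) (charK : [pchar K] =i pred0).
Variables (d j : nat).
Hypotheses (j_ge1 : (1 <= j)%N) (j_le : (4 * j <= d - 1)%N).

Lemma has_WLP_ideal_I i : i <> (d - 1)%N -> has_WLP_in_degree (@ideal_I K d j) i.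
Proof.
move=> id; rewrite ideal_IE //; apply: general_form_coefs => l l_neq0.
have [lt|ge] := ltnP i.+1 d; first exact: mul_rank_lt.
by apply: mul_rank_gt => //; lia.
Qed.

Lemma general_injective_surjective_ideal_I : general_form (fun l : dhomog 3 K 1 => forall i : nat,
  ((i.+1 < d)%N -> mul_injective (@ideal_I K d j) i l) /\
  ((i.+1 > d)%N -> mul_surjective (@ideal_I K d j) i l)).
Proof.
rewrite ideal_IE //; apply: general_form_coefs => l l_neq0 i; split.
  exact: mul_injective_genI.
exact: (mul_surjective_genI j_ge1 j_le l_neq0).
Qed.

Lemma fails_WLP_ideal_I : fails_WLP_by (@ideal_I K d j) (d - 1) j.
Proof.
rewrite ideal_IE //; apply: general_form_coefs => l l_neq0.
by apply: fails_WLP_genI => //; lia.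
Qed.

End Statements12.

(** * The toric variety *)

Lemma digits_inj B n (f g : nat -> nat) :
  (forall i, (i < n)%N -> f i < B)%N -> (forall i, (i < n)%N -> g i < B)%N ->
  (\sum_(i < n) f i * B ^ i = \sum_(i < n) g i * B ^ i)%N ->
  forall i, (i < n)%N -> f i = g i.
Proof.
elim: n f g => // n IH f g fB gB.
rewrite !big_ord_recl /= !muln1.
have sh (h : nat -> nat) : (\sum_(i < n) h (bump 0 i) * B ^ bump 0 i
    = (\sum_(i < n) h i.+1 * B ^ i) * B)%N.
  by rewrite big_distrl; apply: eq_bigr => i _ /=; rewrite /bump add1n expnSr mulnA.
rewrite !sh => E.
have f0 : (f 0 = g 0)%N.
  move/(congr1 (modn^~ B)): E; rewrite ![(_ + _ * B)%N]addnC !modnMDl.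
  by rewrite !modn_small ?fB ?gB.
move=> [//|i] lti; have Bgt0 : (0 < B)%N by have := fB 0%N isT; lia.
apply: (IH (fun i => f i.+1) (fun i => g i.+1)) => // [k kn|k kn|];
  [exact: (fB k.+1) | exact: (gB k.+1) |].
by move/eqP: E; rewrite f0 eqn_add2l eqn_pmul2r // => /eqP.
Qed.

Section Char0.
Variables (K : fieldType) (charK : [pchar K] =i pred0).

Lemma natr_eq0_char0 k : (k%:R == 0 :> K) = (k == 0%N).
Proof. exact: (pcharf0P K).1. Qed.

Lemma natr_inj_char0 : injective (fun k : nat => k%:R : K).
Proof.
have H m n : (m <= n)%N -> m%:R = n%:R :> K -> m = n.
  move=> mn /eqP; rewrite eq_sym -subr_eq0 -natrB // natr_eq0_char0 subn_eq0 => nm.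
  by apply/eqP; rewrite eqn_leq mn.
by move=> m n E; have [/H->//|/ltnW/H->] := leqP m n.
Qed.

(** The sample points k + 1 are nonzero, so that their powers give points of the torus in
    [mpoly_eq0_torus]. *)
Lemma poly_eq0_char0 (p : {poly K}) :
  (forall k, p.[k.+1%:R] = 0) -> p = 0.
Proof.
move=> p0; apply/eqP/negPn/negP => pn0.
have := max_poly_roots pn0 (rs := [seq k.+1%:R | k <- iota 0 (size p)]).
rewrite size_map size_iota ltnn map_inj_uniq ?iota_uniq; last first.
  by move=> m n /natr_inj_char0[].
have -> : all (root p) [seq k.+1%:R | k <- iota 0 (size p)].
  by apply/allP => _ /mapP[k _ ->]; apply/rootP.
by move=> /(_ isT isT).
Qed.

(* Kronecker's substitution x_i := t^(B^i) separates the monomials of [g]. *)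
Lemma mpoly_eq0_torus n (g : {mpoly K[n]}) :
  (forall a, (forall i, a i != 0) -> g.@[a] = 0) -> g = 0.
Proof.
move=> g0; pose B := msize g.
pose kappa (m : 'X_{1..n}) := (\sum_(i < n) m i * B ^ i)%N.
have ltB m : m \in msupp g -> forall i, (m i < B)%N.
  move=> mg i; apply: leq_ltn_trans (msize_mdeg_lt mg).
  by rewrite mdegE (bigD1 i) //= leq_addr.
have kappa_inj : {in msupp g &, injective kappa}.
  move=> m m' mg mg' E; apply/mnmP => i; rewrite !(mnm_nth 0%N).
  apply: (@digits_inj B n (nth 0%N m) (nth 0%N m')) => // [k kn|k kn|].
  - by have := ltB m mg (Ordinal kn); rewrite (mnm_nth 0%N).
  - by have := ltB m' mg' (Ordinal kn); rewrite (mnm_nth 0%N).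
  - move: E; rewrite /kappa; under eq_bigr do rewrite (mnm_nth 0%N).
    by under [RHS]eq_bigr do rewrite (mnm_nth 0%N).
pose p : {poly K} := \sum_(m <- msupp g) g@_m *: 'X^(kappa m).
have p0 : p = 0.
  apply: poly_eq0_char0 => k; rewrite -[RHS](g0 (fun i : 'I_n => k.+1%:R ^+ (B ^ i))).
    rewrite /p horner_sum mevalE; apply: eq_bigr => m _.
    rewrite hornerZ hornerXn /kappa -prodrXr; congr (_ * _).
    by apply: eq_bigr => i _; rewrite -exprM mulnC.
  by move=> i; rewrite expf_neq0 // natr_eq0_char0.
apply/mpolyP => m; rewrite mcoeff0; have [mg|] := boolP (m \in msupp g); last first.
  exact: memN_msupp_eq0.
have : p`_(kappa m) = 0 by rewrite p0 coef0.
rewrite /p coef_sum (bigD1_seq m) //= ?msupp_uniq // coefZ coefXn eqxx mulr1.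
rewrite big_seq_cond big1 ?addr0 // => m' /andP[mg' ne].
rewrite coefZ coefXn; case: eqP => [E|]; last by rewrite mulr0.
by case/eqP: ne; apply: kappa_inj.
Qed.

End Char0.

Section AlgebraicDependence.
Variables (K : fieldType) (n : nat).

Definition mdeg_le (k : nat) (p : {mpoly K[n]}) : Prop :=
  forall m, m \in msupp p -> (mdeg m <= k)%N.

Lemma mdeg_leM k k' p q : mdeg_le k p -> mdeg_le k' q -> mdeg_le (k + k') (p * q).
Proof.
move=> pk qk m /msuppM_le /allpairsP[[u v] /= [/pk uk /qk vk ->]].
by rewrite mdegD leq_add.
Qed.

Lemma mdeg_leX k p e : mdeg_le k p -> mdeg_le (e * k) (p ^+ e).
Proof.
move=> pk; elim: e => [|e IH].
  by move=> m; rewrite expr0 msupp1 inE => /eqP->; rewrite mdeg0.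
by rewrite exprS mulSn; apply: mdeg_leM.
Qed.

Lemma mdeg_le_prod (I : Type) (r : seq I) (F : I -> {mpoly K[n]}) (k : I -> nat) :
  (forall i, mdeg_le (k i) (F i)) ->
  mdeg_le (\sum_(i <- r) k i) (\prod_(i <- r) F i).
Proof.
move=> Fk; elim: r => [|i r IH].
  by move=> m; rewrite !big_nil msupp1 inE => /eqP->; rewrite mdeg0.
by rewrite !big_cons; apply: mdeg_leM.
Qed.

Lemma row_kernel_neq0 p q (A : 'M[K]_(p, q)) : (q < p)%N ->
  exists2 v : 'rV_p, v != 0 & v *m A = 0.
Proof.
move=> qp; have : kermx A != 0.
  by rewrite -mxrank_eq0 mxrank_ker subn_eq0 -ltnNge (leq_ltn_trans (rank_leq_col _)).
by case/rowV0Pn => v /sub_kermxP vA v0; exists v.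
Qed.

(* There are e^(n+1) monomials in n + 1 polynomials with all exponents < e, and
   they live in a space of dimension O(e^n). *)
Lemma algebraic_dependence (h : n.+1.-tuple {mpoly K[n]}) :
  exists2 g : {mpoly K[n.+1]}, g != 0 & g \mPo h = 0.
Proof.
pose D := \max_(k < n.+1) msize (tnth h k).
have hD k : mdeg_le D (tnth h k).
  move=> m /msize_mdeg_lt /ltnW lt; apply: leq_trans lt _.
  exact: (leq_bigmax k).
(* [B = e * c] exceeds the degree of every monomial in [h] with exponents below [e], while e > c^n
   gives B^n < e^(n+1); so the coefficient matrix [A] has more rows than columns. *)
pose c := (n.+1 * D).+1; pose e := (c ^ n).+1; pose B := (e * c)%N.
pose M := {ffun 'I_n.+1 -> 'I_e}; pose N := {ffun 'I_n -> 'I_B}.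
pose mM (u : M) : 'X_{1..n.+1} := [multinom (u i : nat) | i < n.+1].
pose mN (u : N) : 'X_{1..n} := [multinom (u i : nat) | i < n].
pose A : 'M[K]_(#|{: M}|, #|{: N}|) :=
  \matrix_(u, v) ('X_[mM (enum_val u)] \mPo h)@_(mN (enum_val v)).
have ltMN : (#|{: N}| < #|{: M}|)%N.
  rewrite !card_ffun !card_ord /B expnMn expnSr ltn_pmul2l ?expn_gt0 //.
have [v v0 vA] := row_kernel_neq0 A ltMN.
exists (\sum_u v 0 u *: 'X_[mM (enum_val u)]).
  have [u vu] : exists u, v 0 u != 0 by apply/rV0Pn.
  apply: contraNneq vu => /(congr1 (mcoeff (mM (enum_val u)))).
  rewrite mcoeff0 raddf_sum (bigD1 u) //= mcoeffZ mcoeffX eqxx mulr1 big1 ?addr0.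
    by move=> ->.
  move=> u' ne; rewrite mcoeffZ mcoeffX; case: eqP => [E|]; last by rewrite mulr0.
  case/eqP: ne; apply: enum_val_inj; apply/ffunP => i; apply/val_inj.
  by move/mnmP: E => /(_ i); rewrite !mnmE.
rewrite raddf_sum /=; under eq_bigr do rewrite comp_mpolyZ.
have deg u : mdeg_le B.-1 ('X_[mM u] \mPo h).
  rewrite comp_mpolyX => m mu.
  have := mdeg_le_prod (r := index_enum _) (fun i => mdeg_leX (e := mM u i) (hD i)) mu.
  move=> le; apply: leq_trans le _.
  apply: (@leq_trans (\sum_(i < n.+1) e * D)).
    by apply: leq_sum => i _; rewrite leq_mul2r mnmE ltnW ?orbT.
  by rewrite sum_nat_const card_ord /B /c /e; lia.
apply/mpolyP => m; rewrite mcoeff0 raddf_sum /=.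
have [mB|mB] := leqP (mdeg m) B.-1; last first.
  apply: big1 => u _; rewrite mcoeffZ memN_msupp_eq0 ?mulr0 //.
  by apply: contraL mB => /deg; rewrite -leqNgt.
have lt i : (m i < B)%N.
  have Bgt0 : (0 < B)%N by rewrite /B /e /c muln_gt0.
  rewrite -[B]prednK // ltnS; apply: leq_trans mB.
  by rewrite mdegE (bigD1 i) //= leq_addr.
pose w : N := [ffun i => Ordinal (lt i)].
have wE : mN w = m by apply/mnmP => i; rewrite mnmE ffunE.
have /rowP/(_ (enum_rank w)) := vA; rewrite mxE [RHS]mxE => E; rewrite -[RHS]E.
by apply: eq_bigr => u _; rewrite mcoeffZ mxE enum_rankK wE.
Qed.

End AlgebraicDependence.

Lemma root_exists (K : closedFieldType) n (x : K) :
  (0 < n)%N -> exists b, b ^+ n = x.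
Proof.
move=> n_gt0; have [b bE] := solve_monicpoly (fun i => if i == 0%N then x else 0) n_gt0.
exists b; rewrite bE; case: n {bE} n_gt0 => // n _.
rewrite big_ord_recl /= expr0 mulr1 big1 ?addr0 // => i _.
by rewrite mul0r.
Qed.

Section Toric.
Variables (K : fieldType) (charK : [pchar K] =i pred0).
Variables (s : seq 'X_{1..3}) (d : nat).
Hypotheses (d_gt0 : (0 < d)%N) (mdeg_s : forall i : 'I_(size s), mdeg (nth 0%MM s i) = d).

Local Notation N := (size s).
Local Notation sv i := (nth 0%MM s i).

Definition weight (nu : 'X_{1..N}) : 'X_{1..3} :=
  (\sum_(i < N) sv i *+ nu i)%MM.

Definition torus_monomials : N.-tuple {mpoly K[3]} := [tuple 'X_[sv i] | i < N].

Definition toric_variety : ('I_N -> K) -> Prop :=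
  zariski_closure (fun P => nonzero_vec P /\ exists a, P = @monomial_map K 2 s a).

Local Notation X := toric_variety.

Lemma weightU i : weight U_(i) = sv i.
Proof.
rewrite /weight (bigD1 i) //= mnm1E eqxx mulm1n big1 ?addm0 // => k ki.
by rewrite mnm1E eq_sym (negPf ki) mulm0n.
Qed.

Lemma weightD mu nu : weight (mu + nu) = (weight mu + weight nu)%MM.
Proof.
rewrite /weight -big_split; apply: eq_bigr => i _.
by apply/mnmP => k; rewrite !(mulmnE, mnmDE) mulnDr.
Qed.

Lemma weightMn mu k : weight (mu *+ k) = (weight mu *+ k)%MM.
Proof.
by elim: k => [|k IH]; rewrite ?mulm0n ?mulmS ?weightD ?IH // /weight big1 // => i _;
  rewrite mnm0E mulm0n.
Qed.

Lemma mdeg_weight nu : mdeg (weight nu) = (d * mdeg nu)%N.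
Proof.
rewrite mdeg_sum mdegE big_distrr; apply: eq_bigr => i _.
by rewrite mdegMn mdeg_s.
Qed.

Lemma comp_monosX nu : 'X_[nu] \mPo torus_monomials = 'X_[weight nu].
Proof.
rewrite comp_mpolyX /weight (big_morph _ (@mpolyXD 3 K) (@mpolyX0 3 K)).
by apply: eq_bigr => i _; rewrite tnth_mktuple mpolyXn.
Qed.

Lemma comp_monosE f : f \mPo torus_monomials = \sum_(nu <- msupp f) f@_nu *: 'X_[weight nu].
Proof.
rewrite {1}[f]mpolyE raddf_sum /=; apply: eq_bigr => nu _.
by rewrite comp_mpolyZ comp_monosX.
Qed.

Lemma meval_comp_monos f a : (f \mPo torus_monomials).@[a] = f.@[@monomial_map K 2 s a].
Proof.
rewrite comp_mpoly_meval; apply: meval_eq => i.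
by rewrite tnth_mktuple.
Qed.

Lemma monomial_map_neq0 a i : (forall k, a k != 0) -> @monomial_map K 2 s a i != 0.
Proof.
by move=> a0; rewrite /monomial_map mevalX; apply/prodf_neq0 => k _; rewrite expf_neq0.
Qed.

Lemma pihomog_comp_monos e f :
  pihomog mdeg (d * e) (f \mPo torus_monomials) = (pihomog mdeg e f) \mPo torus_monomials.
Proof.
elim/mpolyind: f => [|c nu f _ _ IH]; first by rewrite comp_mpoly0 !pihomog0 comp_mpoly0.
rewrite comp_mpolyD !pihomogD comp_mpolyD IH comp_mpolyZ !linearZ /=.
have E : (mdeg (weight nu) == d * e)%N = (mdeg nu == e).
  by rewrite mdeg_weight eqn_pmul2l.
rewrite comp_monosX !pihomogX [X in if X then _ else _]E.
by case: ifP => _; rewrite ?comp_monosX ?comp_mpoly0.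
Qed.

(** The closure only tests homogeneous forms, so [f] is split into homogeneous components; each
    vanishes on the image because substituting monomials of degree d multiplies degrees by d. *)
Lemma comp_monos_vanish f : f \mPo torus_monomials = 0 -> vanishes_on f X.
Proof.
move=> f0 P [_ XP]; have := @pihomog_partitionE _ _ mdeg (msize f) f (leqnn _).
move=> ->; rewrite raddf_sum /=.
apply: big1 => e _; apply: (XP e); first exact: pihomogP.
move=> _ [_ [a ->]]; rewrite -meval_comp_monos -pihomog_comp_monos f0.
by rewrite !raddf0.
Qed.

(** Substituting the torus monomials identifies exactly the terms of equal weight, so the
    coefficients of [f] sum to 0 over each weight. This serves both for tangent vectors and for the
    parametrisation. *)
Lemma sum_weight f (F : 'X_{1..3} -> K) : f \mPo torus_monomials = 0 ->
  \sum_(nu <- msupp f) f@_nu * F (weight nu) = 0.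
Proof.
move=> f0; pose ws := undup [seq weight nu | nu <- msupp f].
transitivity (\sum_(w <- ws) \sum_(nu <- msupp f) (f@_nu * (weight nu == w)%:R) * F w).
  rewrite exchange_big /= big_seq [RHS]big_seq; apply: eq_bigr => nu nuf.
  rewrite (bigD1_seq (weight nu)) ?undup_uniq //=; last first.
    by rewrite mem_undup map_f.
  rewrite eqxx mulr1 big1 ?addr0 // => w ne.
  by rewrite eq_sym (negPf ne) mulr0 mul0r.
apply: big1 => w _; rewrite -big_distrl /=.
move/(congr1 (mcoeff w)): f0; rewrite mcoeff0 comp_monosE raddf_sum /= => E.
suff -> : \sum_(i <- msupp f) f@_i * (weight i == w)%:R = 0 by rewrite mul0r.
by rewrite -[RHS]E; apply: eq_bigr => nu _; rewrite mcoeffZ mcoeffX.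
Qed.

Hypothesis N_gt0 : (0 < N)%N.

Lemma monomial_map_in a : (forall k, a k != 0) -> X (@monomial_map K 2 s a).
Proof.
move=> a0; have nz : nonzero_vec (@monomial_map K 2 s a).
  by exists (Ordinal N_gt0); exact: monomial_map_neq0.
by split=> // e f _; apply; split=> //; exists a.
Qed.

Lemma vanish_comp_monos f : vanishes_on f X -> f \mPo torus_monomials = 0.
Proof.
move=> fX; apply: (mpoly_eq0_torus charK) => a a0.
by rewrite meval_comp_monos; apply/fX/monomial_map_in.
Qed.

(** Pulled back to the torus, four polynomials become elements of K[x,y,z], which are dependent by
    [algebraic_dependence]. *)
Lemma not_alg_independent4 :
  ~ (exists f : 4.-tuple {mpoly K[N]}, alg_independent_on X f).
Proof.
move=> [f indf]; pose h := [tuple (tnth f k) \mPo torus_monomials | k < 4].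
have [g g0 gh] := algebraic_dependence h.
case/eqP: g0; apply: indf; apply: comp_monos_vanish.
apply: (mpoly_eq0_torus charK) => a _.
rewrite meval_comp_monos comp_mpoly_meval.
rewrite -[RHS](meval0 a) -gh comp_mpoly_meval; apply: meval_eq => k.
by rewrite tnth_mktuple meval_comp_monos.
Qed.

(** Euler's identity: X_i times the i-th partial derivative of X^nu is nu_i X^nu. Hence tangent
    vectors are written as P_i c_i. *)
Lemma euler_weight f (P c : 'I_N -> K) :
  \sum_(i < N) P i * c i * (f^`M(i)).@[P]
  = \sum_(nu <- msupp f) f@_nu * ((\sum_(i < N) c i *+ nu i) * 'X_[nu].@[P]).
Proof.
have D i : (f^`M(i)).@[P] = \sum_(nu <- msupp f) f@_nu * ('X_[nu]^`M(i)).@[P].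
  transitivity ((\sum_(nu <- msupp f) f@_nu *: 'X_[nu])^`M(i)).@[P]; first by rewrite -mpolyE.
  rewrite (linear_sum (mderiv i)) (raddf_sum (meval P)) /=.
  by apply: eq_bigr => nu _; rewrite mderivZ mevalZ.
under eq_bigr => i _ do rewrite D big_distrr /=.
rewrite exchange_big /=; apply: eq_bigr => nu _.
rewrite big_distrl big_distrr /=; apply: eq_bigr => i _.
rewrite mderivX mevalZ.
have [->|nui] := posnP (nu i); first by rewrite mulr0n !(mul0r, mulr0).
have -> : ('X_[nu] : {mpoly K[N]}).@[P] = P i * ('X_[nu - U_(i)]).@[P].
  have {1}-> : nu = (U_(i) + (nu - U_(i)))%MM.
    rewrite addmC submK //; apply/mnm_lepP => k; rewrite mnm1E.
    by case: eqP => // <-.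
  by rewrite mpolyXD mevalM mevalXU.
rewrite -mulr_natr; ring.
Qed.

End Toric.

(** * Torus points: dimension and smoothness *)

Section ToricBase.
Variables (K : closedFieldType) (charK : [pchar K] =i pred0).
Variables (s : seq 'X_{1..3}) (d : nat).
Hypotheses (d_gt0 : (0 < d)%N) (mdeg_s : forall i : 'I_(size s), mdeg (nth 0%MM s i) = d).

Local Notation N := (size s).
Local Notation sv i := (nth 0%MM s i).
Local Notation X := (@toric_variety K s).

Variables (x0 y0 z0 : nat) (i0 i1 i2 : 'I_N).
Hypotheses (si0 : sv i0 = mnm3 x0.+1 y0 z0) (si1 : sv i1 = mnm3 x0 y0.+1 z0)
  (si2 : sv i2 = mnm3 x0 y0 z0.+1).

Let dE : d = (x0.+1 + y0 + z0)%N.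
Proof. by rewrite -(mdeg_s i0) si0 mdeg3 !mnm3E. Qed.

Let N_gt0 : (0 < N)%N.
Proof. exact: leq_ltn_trans (leq0n i0) (ltn_ord i0). Qed.

(* The exponents of the binomial expressing that, in units of [sv i1 - sv i0] and
   [sv i2 - sv i0], the monomial [sv i] lies at (sv i 1 - y0, sv i 2 - z0) from [sv i0];
   the terms are distributed so that no subtraction occurs. *)
Definition base_lhs (i : 'I_N) : 'X_{1..N} :=
  (U_(i) + U_(i1) *+ y0 + U_(i2) *+ z0 + U_(i0) *+ (sv i 1%R + sv i 2%R))%MM.

Definition base_rhs (i : 'I_N) : 'X_{1..N} :=
  (U_(i1) *+ sv i 1%R + U_(i2) *+ sv i 2%R + U_(i0) *+ (1 + y0 + z0))%MM.

Lemma weight_base i : weight (base_lhs i) = weight (base_rhs i).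
Proof.
rewrite !weightD !weightMn !weightU si0 si1 si2.
have := mdeg_s i; rewrite mdeg3 dE => di.
apply/mnm3P; rewrite !mnmDE !mulmnE !mnm3E; split.
- nia.
- nia.
- nia.
Qed.

Definition base_binomial i : {mpoly K[N]} := 'X_[base_lhs i] - 'X_[base_rhs i].

Lemma base_binomial_vanish i : vanishes_on (base_binomial i) X.
Proof.
apply: (comp_monos_vanish d_gt0 mdeg_s).
by rewrite /base_binomial comp_mpolyB !comp_monosX weight_base subrr.
Qed.

Lemma base_binomial_eval i P : X P ->
  ('X_[base_lhs i]).@[P] = ('X_[base_rhs i] : {mpoly K[N]}).@[P].
Proof.
by move=> /(base_binomial_vanish i)/eqP; rewrite /base_binomial mevalB subr_eq0 => /eqP.
Qed.

(** The point is (b, bt, bu) with t = p1/p0, u = p2/p0 and b^d = p0 / (t^y0 u^z0), so that its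
    coordinates at [i0], [i1], [i2] are p0, p1, p2. The factors t^y0 and u^z0 stay on the left to
    avoid negative exponents. *)
Lemma torus_lift (p0 p1 p2 : K) : p0 != 0 -> p1 != 0 -> p2 != 0 ->
  exists2 a : 'I_3 -> K, forall k, a k != 0 &
   forall i, @monomial_map K 2 s a i * (p1 / p0) ^+ y0 * (p2 / p0) ^+ z0
     = p0 * (p1 / p0) ^+ sv i 1 * (p2 / p0) ^+ sv i 2.
Proof.
move=> p00 p10 p20; set t := p1 / p0; set u := p2 / p0.
have t0 : t != 0 by rewrite mulf_neq0 ?invr_eq0.
have u0 : u != 0 by rewrite mulf_neq0 ?invr_eq0.
have [b bE] := root_exists (p0 / (t ^+ y0 * u ^+ z0)) d_gt0.
have b0 : b != 0.
  have : b ^+ d != 0 by rewrite bE mulf_neq0 ?invr_eq0 ?mulf_neq0 ?expf_neq0.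
  by rewrite expf_eq0 d_gt0.
exists (fun k : 'I_3 => nth 0 [:: b; b * t; b * u] k).
  by apply/forall_ord3; split=> //=; rewrite mulf_neq0.
move=> i; rewrite /monomial_map mevalX !big_ord_recr big_ord0 /= mul1r.
rewrite (_ : widen_ord _ _ = 0); last exact/val_inj.
rewrite (_ : widen_ord _ _ = 1); last exact/val_inj.
rewrite (_ : ord_max = 2); last exact/val_inj.
have E : b ^+ sv i 0 * (b * t) ^+ sv i 1 * (b * u) ^+ sv i 2
   = b ^+ d * t ^+ sv i 1 * u ^+ sv i 2.
  rewrite -(mdeg_s i) mdeg3 !exprMn !exprD; ring.
rewrite E bE; field.
by rewrite !expf_neq0.
Qed.

(** The binomials [base_binomial] determine each coordinate from those at [i0], [i1], [i2], and
    [torus_lift] matches these three. *)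
Lemma toric_torus P : X P -> (forall i, P i != 0) ->
  exists2 a : 'I_3 -> K, forall k, a k != 0 & P = @monomial_map K 2 s a.
Proof.
move=> XP P0; have [a a0 aE] := torus_lift (P0 i0) (P0 i1) (P0 i2).
exists a => //; apply/funext => i.
set t := P i1 / P i0 in aE; set u := P i2 / P i0 in aE.
have t0 : t != 0 by rewrite mulf_neq0 ?invr_eq0.
have u0 : u != 0 by rewrite mulf_neq0 ?invr_eq0.
apply: (mulIf (expf_neq0 y0 t0)); apply: (mulIf (expf_neq0 z0 u0)); rewrite aE.
have := base_binomial_eval i XP; rewrite /base_lhs /base_rhs.
rewrite !mpolyXD -!mpolyXn !mevalM !rmorphXn /= !mevalXU.
rewrite (_ : P i1 = P i0 * t); last by rewrite /t mulrC divfK.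
rewrite (_ : P i2 = P i0 * u); last by rewrite /u mulrC divfK.
rewrite !exprMn !exprD expr1 => E.
apply: (mulIf (expf_neq0 (y0 + z0 + (sv i 1%R + sv i 2%R)) (P0 i0))).
rewrite !exprD; apply: etrans (etrans _ E) _; ring.
Qed.

(** By [torus_lift] these coordinates take all triples of nonzero values on X, so a relation
    vanishes on a torus. *)
Lemma torus_alg_independent : alg_independent_on X [tuple 'X_i0; 'X_i1; 'X_i2].
Proof.
move=> g gX; apply: (mpoly_eq0_torus charK) => p p0.
have [a a0 aE] := torus_lift (p0 0) (p0 1) (p0 2).
have := gX _ (monomial_map_in N_gt0 a0); rewrite comp_mpoly_meval => <-.
apply: meval_eq; set t := p 1 / p 0 in aE; set u := p 2 / p 0 in aE.
have t0 : t != 0 by rewrite mulf_neq0 ?invr_eq0.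
have u0 : u != 0 by rewrite mulf_neq0 ?invr_eq0.
apply/forall_ord3; rewrite !(tnth_nth 0) /= !mevalXU; split.
all: apply: (mulIf (expf_neq0 y0 t0)); apply: (mulIf (expf_neq0 z0 u0)); rewrite aE.
- by rewrite si0 !mnm3E.
- by rewrite si1 !mnm3E exprS /t; field.
- by rewrite si2 !mnm3E [u ^+ z0.+1]exprS /u; field.
Qed.

Lemma has_dim_toric : has_dim X 2.
Proof.
split; first by exists [tuple 'X_i0; 'X_i1; 'X_i2]; exact: torus_alg_independent.
exact: (not_alg_independent4 charK d_gt0 mdeg_s).
Qed.

(** Affine functions on the plane |s| = d, in the coordinates s_1 and s_2; multiplied by P they form
    the tangent space of the cone at P. *)
Definition affine_fun (c : 'rV[K]_3) (i : 'I_N) : K :=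
  c 0 0 + c 0 1 * (sv i 1)%:R + c 0 2 * (sv i 2)%:R.

Definition tangent_map (P : 'I_N -> K) : 'M[K]_(3, N) :=
  \matrix_(k, i) (P i * nth 0 [:: 1; (sv i 1)%:R; (sv i 2)%:R] k).

Lemma tangent_mapE P c : c *m tangent_map P = \row_i (P i * affine_fun c i).
Proof.
apply/rowP => i; rewrite !mxE !big_ord_recr big_ord0 /= add0r !mxE /=.
rewrite (_ : widen_ord _ _ = 0); last exact/val_inj.
rewrite (_ : widen_ord _ _ = 1); last exact/val_inj.
rewrite (_ : ord_max = 2); last exact/val_inj.
rewrite /affine_fun; ring.
Qed.

Lemma smooth_torus (a : 'I_3 -> K) : (forall k, a k != 0) ->
  smooth_point X 2 (@monomial_map K 2 s a).
Proof.
move=> a0; set P := monomial_map a; split; first exact: monomial_map_in.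
have P0 i : P i != 0 by exact: monomial_map_neq0.
have d0 : d%:R != 0 :> K by rewrite natr_eq0_char0 // -lt0n.
pose f : 'Hom('rV[K]_3, 'rV[K]_N) := linfun (mulmxr (tangent_map P)).
exists (limg f).
  rewrite limg_dim_eq ?dimvf /dim //= capfv; apply/eqP; rewrite -subv0.
  apply/subvP => c; rewrite memv_ker lfunE /= tangent_mapE memv0 => /eqP/rowP E.
  have Ei i : affine_fun c i = 0.
    by move: (E i); rewrite !mxE => /eqP; rewrite mulf_eq0 (negPf (P0 i)) => /eqP.
  (* The exponents at [i0], [i1], [i2] are affinely independent, so an affine function vanishing
     there is zero. *)
  move: (Ei i0) (Ei i1) (Ei i2); rewrite /affine_fun si0 si1 si2 !mnm3E.
  rewrite -[y0.+1]addn1 -[z0.+1]addn1 !natrD => E0 E1 E2.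
  have c1 : c 0 1 = 0 by have := congr2 (fun u v => u - v) E1 E0; rewrite subrr => <-; ring.
  have c2 : c 0 2 = 0 by have := congr2 (fun u v => u - v) E2 E0; rewrite subrr => <-; ring.
  have c0 : c 0 0 = 0 by rewrite -E0 c1 c2; ring.
  by apply/eqP/rowP; apply/forall_ord3; rewrite !mxE.
move=> v; split=> [/memv_imgP[c _ ->] g gX|vX].
  rewrite lfunE /= tangent_mapE; under eq_bigr => i _ do rewrite mxE.
  rewrite euler_weight.
  have g0 : g \mPo torus_monomials K s = 0 by exact: vanish_comp_monos.
  (* Since |nu| = mdeg (weight nu) / d, the constant term of [affine_fun] also contributes a
     function of the weight, as [sum_weight] requires. *)
  pose F (w : 'X_{1..3}) := (c 0 0 * (mdeg w)%:R / d%:R + c 0 1 * (w 1)%:R + c 0 2 * (w 2)%:R)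
    * ('X_[w] : {mpoly K[3]}).@[a].
  rewrite -[RHS](sum_weight F g0); apply: eq_bigr => nu _; congr (_ * _).
  rewrite /F -comp_monosX meval_comp_monos; congr (_ * _).
  rewrite (mdeg_weight mdeg_s) natrM -[_ / d%:R]mulrA (mulrAC d%:R) divff // mul1r.
  have wE k : ((weight nu) k)%:R = \sum_(i < N) (sv i k)%:R * (nu i)%:R :> K.
    rewrite /weight mnm_sumE natr_sum; apply: eq_bigr => i _.
    by rewrite mulmnE natrM.
  rewrite !wE mdegE natr_sum !big_distrr -!big_split; apply: eq_bigr => i _ /=.
  rewrite /affine_fun -mulr_natr; ring.
apply/memv_imgP.
pose w i := v 0 i / P i.
have vE i : v 0 i = P i * w i by rewrite /w mulrC divfK.
(* The binomial of [i] forces on [w] the affine relation between the exponent at [i] and those at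
   [i0], [i1], [i2]. *)
have rel i : w i + w i1 *+ y0 + w i2 *+ z0 + w i0 *+ (sv i 1%R + sv i 2%R)
   = w i1 *+ sv i 1%R + w i2 *+ sv i 2%R + w i0 *+ (1 + y0 + z0).
  pose ws (mu : 'X_{1..N}) := \sum_(k < N) w k *+ mu k.
  have wsU k : ws U_(k)%MM = w k.
    rewrite /ws (bigD1 k) //= mnm1E eqxx mulr1n big1 ?addr0 // => k' ne.
    by rewrite mnm1E eq_sym (negPf ne).
  have wsD mu nu : ws (mu + nu)%MM = ws mu + ws nu.
    by rewrite -big_split; apply: eq_bigr => k _; rewrite mnmDE mulrnDr.
  have wsMn mu m : ws (mu *+ m)%MM = ws mu *+ m.
    by rewrite -sumrMnl; apply: eq_bigr => k _; rewrite mulmnE mulrnA.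
  suff : ws (base_lhs i) = ws (base_rhs i) by rewrite !wsD !wsMn !wsU.
  (* By Euler's identity the derivative of the binomial along v = P w is the common nonzero value of
     its two monomials times [ws mu - ws nu]. *)
  have cancel_ws (mu nu : 'X_{1..N}) : 'X_[mu].@[P] = ('X_[nu] : {mpoly K[N]}).@[P] ->
      \sum_(k < N) v 0 k * (('X_[mu] - 'X_[nu])^`M(k)).@[P] = 0 -> ws mu = ws nu.
    move=> E; under eq_bigr => k _ do rewrite vE mderivB mevalB mulrBr.
    rewrite sumrB !euler_weight !msuppX !big_seq1 !mcoeffX !eqxx !mul1r E -mulrBl.
    move/eqP; rewrite mulf_eq0 subr_eq0 => /orP[/eqP //|].
    rewrite mevalX => /negPn/negP []; apply/prodf_neq0 => k _.
    by rewrite expf_neq0.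
  apply: cancel_ws; first exact/base_binomial_eval/monomial_map_in.
  exact: (vX _ (@base_binomial_vanish i)).
(* The affine function with the values of [w] at [i0], [i1], [i2]. *)
exists (\row_k nth 0 [:: w i0 - (w i1 - w i0) * y0%:R - (w i2 - w i0) * z0%:R;
  w i1 - w i0; w i2 - w i0] k).
  exact: memvf.
rewrite lfunE /= tangent_mapE; apply/rowP => i; rewrite !mxE vE /affine_fun !mxE /=.
congr (_ * _); move: (rel i); rewrite -![w _ *+ _]mulr_natr !natrD => R.
apply: (addIr (w i1 * y0%:R + w i2 * z0%:R + w i0 * ((sv i 1)%:R + (sv i 2)%:R))).
rewrite !addrA R; ring.
Qed.

End ToricBase.

(** * Osculating spaces *)

Section FormalExponential.
Variables (K : fieldType) (charK : [pchar K] =i pred0) (n : nat).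
Implicit Types (al be : 'I_n -> K) (mu nu : 'X_{1..n}) (p q : {mpoly K[n]}).

(** Coefficients of the formal exponential of the linear form al_1 t_1 + ... + al_n t_n. *)
Definition exp_coef al mu : K := \prod_(k < n) (al k ^+ mu k / (mu k)`!%:R).

Lemma fact_neq0_char0 m : m`!%:R != 0 :> K.
Proof. by rewrite natr_eq0_char0 // -lt0n fact_gt0. Qed.

Lemma exp_coef0 al : exp_coef al 0%MM = 1.
Proof. by apply: big1 => k _; rewrite mnm0E expr0 fact0 divr1. Qed.

Lemma exp_coefS al mu k :
  exp_coef al (mu + U_(k))%MM *+ (mu k).+1 = al k * exp_coef al mu.
Proof.
rewrite /exp_coef (bigD1 k) //= [in RHS](bigD1 k) //= mulrA -mulrnAl; congr (_ * _).
  rewrite mnmDE mnm1E eqxx addn1 exprS factS natrM -mulr_natr.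
  have := fact_neq0_char0 (mu k); have : (mu k).+1%:R != 0 :> K by rewrite natr_eq0_char0.
  move: (_.+1%:R) (_`!%:R) => u v u0 v0; field.
  by rewrite u0 v0.
by apply: eq_bigr => i ne; rewrite mnmDE mnm1E eq_sym (negPf ne) addn0.
Qed.

Lemma mnm_neq0_ex mu : mu <> 0%MM -> exists k, mu k != 0%N.
Proof.
move=> ne; case: (pickP (fun k => mu k != 0%N)) => [k|H]; first by exists k.
by case: ne; apply/mnmP => k; rewrite mnm0E; apply/eqP/negPn; rewrite H.
Qed.

Lemma exp_coef_zero mu : exp_coef (fun=> 0) mu = (mu == 0%MM)%:R.
Proof.
have [->|/eqP/mnm_neq0_ex[k mk]] := eqVneq mu 0%MM; first exact: exp_coef0.
by rewrite /exp_coef (bigD1 k) //= expr0n (negPf mk) !mul0r.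
Qed.

Definition exp_upto M p c al : Prop :=
  forall mu, (mdeg mu <= M)%N -> p@_mu = c * exp_coef al mu.

(** An exponential is determined by its constant term and the equations saying that its k-th
    derivative is al_k times itself; differentiation loses one degree, hence the congruence modulo
    degree [M]. In this form products reduce to the Leibniz rule. *)
Lemma exp_uptoP M p c al : exp_upto M p c al <->
  p@_0%MM = c /\ forall k, monomial_ideal (fun mu => (M <= mdeg mu)%N) (p^`M(k) - al k *: p).
Proof.
split=> [pE|[p0 dp]].
  split; first by rewrite pE ?mdeg0 // exp_coef0 mulr1.
  move=> k mu; rewrite mcoeff_msupp leqNgt; apply: contraNN => lt.
  rewrite mcoeffB mcoeffZ mcoeff_mderiv !pE ?(ltnW lt) ?mdegD ?mdeg1 ?addn1 //.
  by rewrite mulrCA -exp_coefS mulrnAr subrr.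
move=> mu; have [m] := ubnP (mdeg mu); elim: m mu => // m IH mu lt leM.
have [->|/eqP/mnm_neq0_ex[k mk]] := eqVneq mu 0%MM; first by rewrite p0 exp_coef0 mulr1.
have muE : mu = (mu - U_(k) + U_(k))%MM.
  by rewrite submK //; apply/mnm_lepP => t; rewrite mnm1E; case: eqP => // <-; rewrite lt0n.
move: (mu - U_(k))%MM muE => nu muE; rewrite muE.
have ltnu : (mdeg nu < mdeg mu)%N by rewrite muE mdegD mdeg1 addn1.
have IHn : p@_nu = c * exp_coef al nu by apply: IH; lia.
have := dp k nu; rewrite mcoeff_msupp leqNgt (leq_trans ltnu leM) /=.
case: eqP => [E _|_ /(_ isT)] //.
have nz : (nu k).+1%:R != 0 :> K by rewrite natr_eq0_char0.
move/eqP: E; rewrite mcoeffB mcoeffZ mcoeff_mderiv subr_eq0 IHn mulrCA.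
rewrite -exp_coefS mulrnAr -(mulr_natr p@__) -(mulr_natr (c * _)).
by move/eqP/(mulIf nz).
Qed.

Lemma exp_uptoM M p q c c' al be : exp_upto M p c al -> exp_upto M q c' be ->
  exp_upto M (p * q) (c * c') (fun k => al k + be k).
Proof.
move=> /exp_uptoP[p0 dp] /exp_uptoP[q0 dq]; apply/exp_uptoP; split.
  by rewrite rmorphM /= p0 q0.
move=> k; rewrite mderivM.
have up : up_closed (fun mu : 'X_{1..n} => (M <= mdeg mu)%N).
  by move=> u v Mu; rewrite mdegD (leq_trans Mu) ?leq_addr.
rewrite (_ : _ - _ = (p^`M(k) - al k *: p) * q + (q^`M(k) - be k *: q) * p).
  by apply: monomial_idealD; apply: monomial_idealM.
rewrite !mulrBl -!scalerAl scalerDl [q * p]mulrC [_ * p]mulrC.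
by rewrite opprD !addrA; congr (_ - _); rewrite addrAC.
Qed.

Lemma exp_upto1 M : exp_upto M 1 1 (fun=> 0).
Proof. by move=> mu _; rewrite mcoeff1 mul1r exp_coef_zero. Qed.

Lemma exp_upto_ext M p c al be : al =1 be -> exp_upto M p c al -> exp_upto M p c be.
Proof. by move=> /funext->. Qed.

Lemma exp_uptoX M p c al e : exp_upto M p c al ->
  exp_upto M (p ^+ e) (c ^+ e) (fun k => al k *+ e).
Proof.
move=> pE; elim: e => [|e IH].
  by rewrite !expr0; apply: (exp_upto_ext _ (@exp_upto1 M)) => k; rewrite mulr0n.
rewrite !exprS; apply: (exp_upto_ext _ (exp_uptoM pE IH)) => k.
by rewrite mulrS.
Qed.

Lemma exp_upto_prod M (I : Type) (r : seq I) (p : I -> {mpoly K[n]}) c (al : I -> 'I_n -> K) :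
  (forall i, exp_upto M (p i) (c i) (al i)) ->
  exp_upto M (\prod_(i <- r) p i) (\prod_(i <- r) c i) (fun k => \sum_(i <- r) al i k).
Proof.
move=> pE; elim: r => [|i r IH].
  by rewrite !big_nil; apply: (exp_upto_ext _ (@exp_upto1 M)) => k; rewrite big_nil.
rewrite !big_cons; apply: (exp_upto_ext _ (exp_uptoM (pE i) IH)) => k.
by rewrite big_cons.
Qed.

Lemma exp_upto_trunc M c al :
  exp_upto M (fps_trunc M (fun mu => c * exp_coef al mu)) c al.
Proof. by move=> mu le; rewrite /fps_trunc (mcoeff_mpoly (fun mu => c * exp_coef al mu)). Qed.

End FormalExponential.

Section LocalParam.
Variables (K : closedFieldType) (charK : [pchar K] =i pred0).
Variables (s : seq 'X_{1..3}) (d : nat).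
Hypotheses (d_gt0 : (0 < d)%N) (mdeg_s : forall i : 'I_(size s), mdeg (nth 0%MM s i) = d).

Local Notation N := (size s).
Local Notation sv i := (nth 0%MM s i).
Local Notation X := (@toric_variety K s).

Variables (x0 y0 z0 : nat) (i0 i1 i2 : 'I_N).
Hypotheses (si0 : sv i0 = mnm3 x0.+1 y0 z0) (si1 : sv i1 = mnm3 x0 y0.+1 z0)
  (si2 : sv i2 = mnm3 x0 y0 z0.+1).
Variable a : 'I_3 -> K.
Hypothesis a0 : forall k, a k != 0.

Let N_gt0 : (0 < N)%N.
Proof. exact: leq_ltn_trans (leq0n i0) (ltn_ord i0). Qed.

Local Notation P := (@monomial_map K 2 s a).
Let P0 i : P i != 0. Proof. exact: monomial_map_neq0. Qed.

(** Logarithmic exponents of a monomial of degree [e] in the coordinates of X and of weight [w]: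
    dividing by the e-th power of the coordinate [i0] subtracts e (y0, z0). *)
Definition exponents (w : 'X_{1..3}) (e : nat) (k : 'I_2) : K :=
  nth 0 [:: (w 1)%:R - (e * y0)%:R; (w 2)%:R - (e * z0)%:R] k.

(** The torus orbit of P in logarithmic coordinates, normalised so that the coordinate [i0] is 1. *)
Definition exp_param (i : 'I_N) : fps K 2 :=
  fun mu => P i / P i0 * exp_coef (exponents (sv i) 1) mu.

Lemma deriv_row_exp nu :
  deriv_row exp_param nu = \row_i (P i / P i0 * \prod_(k < 2) exponents (sv i) 1 k ^+ nu k).
Proof.
apply/rowP => i; rewrite !mxE /fps_mderiv add0m /exp_param -mulrnAr; congr (_ * _).
rewrite -(mulr_natr (exp_coef _ _)) natr_prod /exp_coef -big_split; apply: eq_bigr => k _ /=.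
by rewrite mnm0E add0n ffactnn divfK // fact_neq0_char0.
Qed.

Lemma exp_param_vanish f mu : vanishes_on f X -> fps_subst f exp_param mu = 0.
Proof.
move=> fX; have f0 := vanish_comp_monos charK N_gt0 fX.
(* A product of exponentials adds their exponents, so each term depends on [nu] only through its
   weight; [mdeg w %/ d] recovers the degree of [nu]. *)
pose F (w : 'X_{1..3}) := ('X_[w] : {mpoly K[3]}).@[a] / P i0 ^+ (mdeg w %/ d)
   * exp_coef (exponents w (mdeg w %/ d)) mu.
rewrite -[RHS](sum_weight F f0) /fps_subst comp_mpolyEX raddf_sum /=.
apply: eq_bigr => nu _; rewrite mcoeffZ; congr (_ * _).
rewrite comp_mpolyX.
have E i : exp_upto (mdeg mu) (tnth [tuple fps_trunc (mdeg mu) (exp_param i) | i < N] i)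
    (P i / P i0) (exponents (sv i) 1).
  by rewrite tnth_mktuple; exact: exp_upto_trunc.
have := exp_upto_prod charK (index_enum _) (fun i => exp_uptoX charK (nu i) (E i)).
move=> /(_ mu (leqnn _)) ->; rewrite /F (mdeg_weight mdeg_s) mulKn //.
congr (_ * _); last congr exp_coef.
  rewrite -comp_monosX meval_comp_monos mevalX mdegE -prodrXr -prodf_div.
  by apply: eq_bigr => i _; rewrite expr_div_n.
apply/funext => k; rewrite /exponents.
have wE k' (c : nat) : \sum_(i < N) ((sv i k')%:R - (1 * c)%:R) *+ nu i
    = (weight nu k')%:R - (mdeg nu * c)%:R :> K.
  rewrite /weight mnm_sumE mdegE big_distrl !natr_sum -sumrB; apply: eq_bigr => i _.
  by rewrite mul1n mulmnE mulrnBl -!mulrnA [(c * _)%N]mulnC.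
by case: k => [[|[|//]] ltk] /=; rewrite wE.
Qed.

Lemma local_param_exp : local_param X P exp_param.
Proof.
split.
- exists i0; split=> //.
    apply/funext => mu; rewrite /exp_param divff // mul1r /fps1 -exp_coef_zero //.
    congr exp_coef; apply/funext => k; rewrite /exponents si0 !mnm3E !mul1n !subrr.
    by case: k => [[|[|//]]].
  by move=> i; rewrite /exp_param exp_coef0 mulr1.
- by move=> f fX mu; exact: exp_param_vanish.
- have -> : [seq deriv_row exp_param U_(b)%MM | b : 'I_2]
      = [:: deriv_row exp_param U_(0%R)%MM; deriv_row exp_param U_(1%R)%MM].
    rewrite /image_mem enum_ordSl enum_ordSl enum_ord0 /=.
    by congr [:: deriv_row _ U_(_)%MM; deriv_row _ U_(_)%MM]; exact/val_inj.
  have rowE (b : 'I_2) i : deriv_row exp_param U_(b)%MM 0 i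
      = P i / P i0 * exponents (sv i) 1 b.
    rewrite deriv_row_exp mxE (bigD1 b) //= mnm1E eqxx expr1 big1 ?mulr1 // => k ne.
    by rewrite mnm1E eq_sym (negPf ne) expr0.
  have PP i : P i / P i0 != 0 by rewrite mulf_neq0 ?invr_eq0.
  have scE c (v : 'rV[K]_N) i : (c *: v) 0 i = c * v 0 i by rewrite mxE.
  have zE i : (0 : 'rV[K]_N) 0 i = 0 by rewrite mxE.
  (* At [i1] and [i2] the exponents are (1, 0) and (0, 1), so these coordinates separate the two
     rows. *)
  rewrite free_cons seq1_free span_seq1; apply/andP; split.
    apply/vlineP => -[c /rowP/(_ i1)]; rewrite scE !rowE /exponents si1 !mnm3E /=.
    rewrite !mul1n subrr !mulr0 -natrB // subSnn mulr1 => /eqP.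
    by rewrite (negPf (PP i1)).
  apply/eqP => /rowP/(_ i2); rewrite zE !rowE /exponents si2 !mnm3E /=.
  rewrite !mul1n -natrB // subSnn mulr1 => /eqP.
  by rewrite (negPf (PP i2)).
Qed.

End LocalParam.

Section Osculating.
Variables (K : closedFieldType) (charK : [pchar K] =i pred0).
Variables (U : 'X_{1..3} -> Prop) (s : seq 'X_{1..3}) (D : nat).
Local Notation d := D.+1.
Hypothesis mdeg_s : forall i : 'I_(size s), mdeg (nth 0%MM s i) = d.
Hypothesis sU : forall m, mdeg m = d -> (m \in s <-> ~ U m).

Local Notation N := (size s).
Local Notation sv i := (nth 0%MM s i).
Local Notation I := (monomial_ideal (K := K) U).

Variables (y0 z0 : nat) (i0 : 'I_N).
Variable a : 'I_3 -> K.
Hypothesis a0 : forall k, a k != 0.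

Local Notation P := (@monomial_map K 2 s a).
Let P0 i : P i != 0. Proof. exact: monomial_map_neq0. Qed.

Local Notation c i := (P i / P i0).
Let c0 i : c i != 0. Proof. by rewrite mulf_neq0 ?invr_eq0. Qed.

Definition scaled_row (h : 'I_N -> K) : 'rV[K]_N := \row_i (c i * h i).

(* On exponents of degree d = D + 1 the [falling u] with mdeg u = D span all
   polynomials of degree at most D, by [falling_sum]; [sv i] contributes to it only if
   it is [u] plus a unit vector, see [coef_row_mul]. *)
Definition falling (u : 'X_{1..3}) (i : 'I_N) : K := \prod_(k < 3) ((sv i k) ^_ (u k))%:R.

Lemma ffactSR (m n : nat) : (n ^_ m.+1)%:R = (n ^_ m)%:R * (n%:R - m%:R) :> K.
Proof.
rewrite ffactnSr natrM; have [le|lt] := leqP m n; first by rewrite natrB.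
by rewrite ffact_small // !mul0r.
Qed.

Lemma fallingS u k i : falling (u + U_(k))%MM i = falling u i * ((sv i k)%:R - (u k)%:R).
Proof.
rewrite /falling (bigD1 k) //= [in RHS](bigD1 k) //= mnmDE mnm1E eqxx addn1 ffactSR.
rewrite mulrAC; congr (_ * _ * _); apply: eq_bigr => k' ne.
by rewrite mnmDE mnm1E eq_sym (negPf ne) addn0.
Qed.

Lemma sum_exponents (i : 'I_N) : (sv i 0)%:R + (sv i 1)%:R + (sv i 2)%:R = d%:R :> K.
Proof. by rewrite -(mdeg_s i) mdeg3 !natrD. Qed.

(** The three factors s_k - u_k add up to d - |u|, which is nonzero because |u| <= D. *)
Lemma falling_sum u i : (mdeg u <= D)%N ->
  falling u i = ((d - mdeg u)%:R)^-1 *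
    (falling (u + U_(0%R))%MM i + falling (u + U_(1%R))%MM i + falling (u + U_(2%R))%MM i).
Proof.
move=> uD; rewrite !fallingS -!mulrDr.
have -> : (sv i 0)%:R - (u 0)%:R + ((sv i 1)%:R - (u 1)%:R) + ((sv i 2)%:R - (u 2)%:R)
    = (d - mdeg u)%:R :> K.
  by rewrite natrB ?(leqW uD) // -(sum_exponents i) mdeg3 !natrD; ring.
rewrite mulrCA mulVf ?mulr1 // natr_eq0_char0 // subn_eq0 -ltnNge ltnS //.
Qed.

Definition ycoord (i : 'I_N) : K := exponents K y0 z0 (sv i) 1 0.
Definition zcoord (i : 'I_N) : K := exponents K y0 z0 (sv i) 1 1.
Definition mono2 (nu : 'X_{1..2}) (i : 'I_N) : K :=
  \prod_(k < 2) exponents K y0 z0 (sv i) 1 k ^+ nu k.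

Lemma mono2S nu k i :
  mono2 (nu + U_(k))%MM i = mono2 nu i * exponents K y0 z0 (sv i) 1 k.
Proof.
rewrite /mono2 (bigD1 k) //= [in RHS](bigD1 k) //= mnmDE mnm1E eqxx addn1 exprSr.
rewrite mulrAC; congr (_ * _ * _); apply: eq_bigr => k' ne.
by rewrite mnmDE mnm1E eq_sym (negPf ne) addn0.
Qed.

Section RowSpace.
Variable W : {vspace 'rV[K]_N}.

Lemma scaled_row_lin e h e' h' g :
  (forall i, g i = e * h i + e' * h' i) ->
  scaled_row h \in W -> scaled_row h' \in W -> scaled_row g \in W.
Proof.
move=> gE hW h'W.
have -> : scaled_row g = e *: scaled_row h + e' *: scaled_row h'.
  by apply/rowP => i; rewrite !mxE gE; ring.
by rewrite memvD ?memvZ.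
Qed.

Lemma falling_sub : (forall u, mdeg u = D -> scaled_row (falling u) \in W) ->
  forall u, (mdeg u <= D)%N -> scaled_row (falling u) \in W.
Proof.
move=> WD u; have [m] := ubnP (D - mdeg u); elim: m u => // m IH u lt uD.
have [|ne] := eqVneq (mdeg u) D; first exact: WD.
have WS k : scaled_row (falling (u + U_(k))%MM) \in W.
  by apply: IH; rewrite mdegD mdeg1; lia.
apply: (@scaled_row_lin 1 (fun i => (d - mdeg u)%:R^-1
      * (falling (u + U_(0%R))%MM i + falling (u + U_(1%R))%MM i))
    ((d - mdeg u)%:R^-1) (falling (u + U_(2%R))%MM)) => //.
  by move=> i; rewrite falling_sum //; ring.
by apply: (@scaled_row_lin (d - mdeg u)%:R^-1 _ (d - mdeg u)%:R^-1
  _ _ _ (WS 0) (WS 1)) => i; ring.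
Qed.

(** A factor s_k - b of [mono2] is traded for degree in [falling] by (s_k - b) f_u = f_(u+e_k) +
    (u_k - b) f_u. *)
Lemma mono2_falling_sub : (forall u, (mdeg u <= D)%N -> scaled_row (falling u) \in W) ->
  forall nu u, (mdeg nu + mdeg u <= D)%N ->
    scaled_row (fun i => mono2 nu i * falling u i) \in W.
Proof.
move=> WD nu; have [m] := ubnP (mdeg nu); elim: m nu => // m IH nu lt u nuD.
have [nu0|/eqP/mnm_neq0_ex[k nuk]] := eqVneq nu 0%MM.
  rewrite nu0 mdeg0 in nuD; have := WD u nuD; congr (_ \in W); apply/rowP => i.
  rewrite !mxE nu0 /mono2 big1 ?mul1r // => k _; by rewrite mnm0E.
have nuE : nu = (nu - U_(k) + U_(k))%MM.
  by rewrite submK //; apply/mnm_lepP => t; rewrite mnm1E; case: eqP => // <-; rewrite lt0n.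
move: (nu - U_(k))%MM nuE => nu' nuE; rewrite nuE mdegD mdeg1 in lt nuD *.
have step (k' : 'I_3) (b : nat) :
    (forall i, exponents K y0 z0 (sv i) 1 k = (sv i k')%:R - b%:R) ->
    scaled_row (fun i => mono2 (nu' + U_(k))%MM i * falling u i) \in W.
  move=> kE; apply: (@scaled_row_lin 1 (fun i => mono2 nu' i * falling (u + U_(k'))%MM i)
     ((u k')%:R - b%:R) (fun i => mono2 nu' i * falling u i)).
  - by move=> i; rewrite mono2S kE fallingS; ring.
  - by apply: IH; rewrite ?mdegD ?mdeg1; lia.
  - by apply: IH; lia.
case: k {nuk nuE lt nuD} step => [[|[|//]]] ltk step.
  by apply: (step 1 y0) => i; rewrite /exponents /= mul1n.
by apply: (step 2 z0) => i; rewrite /exponents /= mul1n.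
Qed.

(** The reverse exchange: each s_k is affine in [ycoord] and [zcoord], the x-exponent because the
    exponents sum to d. *)
Lemma falling_mono2_sub : (forall nu, (mdeg nu <= D)%N -> scaled_row (mono2 nu) \in W) ->
  forall u nu, (mdeg nu + mdeg u <= D)%N ->
    scaled_row (fun i => mono2 nu i * falling u i) \in W.
Proof.
move=> WD u; have [m] := ubnP (mdeg u); elim: m u => // m IH u lt nu nuD.
have [u0|/eqP/mnm_neq0_ex[k uk]] := eqVneq u 0%MM.
  rewrite u0 mdeg0 addn0 in nuD; have := WD nu nuD; congr (_ \in W); apply/rowP => i.
  rewrite !mxE u0 /falling big1 ?mulr1 // => k _; by rewrite mnm0E.
have uE : u = (u - U_(k) + U_(k))%MM.
  by rewrite submK //; apply/mnm_lepP => t; rewrite mnm1E; case: eqP => // <-; rewrite lt0n.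
move: (u - U_(k))%MM uE => u' uE; rewrite uE mdegD mdeg1 in lt nuD *.
have W0 : scaled_row (fun i => mono2 nu i * falling u' i) \in W by apply: IH; lia.
have W1 k' : scaled_row (fun i => mono2 (nu + U_(k'))%MM i * falling u' i) \in W.
  by apply: IH; rewrite ?mdegD ?mdeg1; lia.
have step (b e e' : K) : (forall i : 'I_N, (sv i k)%:R = b + e * ycoord i + e' * zcoord i) ->
    scaled_row (fun i => mono2 nu i * falling (u' + U_(k))%MM i) \in W.
  move=> kE.
  apply: (@scaled_row_lin 1 (fun i => mono2 nu i * falling u' i * (b - (u' k)%:R)
            + mono2 nu i * falling u' i * (e * ycoord i)) e'
            (fun i => mono2 (nu + U_(1%R))%MM i * falling u' i)) => //.
    by move=> i; rewrite mono2S -/(zcoord i) fallingS kE; ring.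
  apply: (@scaled_row_lin (b - (u' k)%:R) _ e _ _ _ W0 (W1 0)) => i.
  by rewrite mono2S -/(ycoord i); ring.
have yE (i : 'I_N) : (sv i 1)%:R = ycoord i + y0%:R by rewrite /ycoord /exponents /= mul1n subrK.
have zE (i : 'I_N) : (sv i 2)%:R = zcoord i + z0%:R by rewrite /zcoord /exponents /= mul1n subrK.
have xE (i : 'I_N) : (sv i 0)%:R = d%:R - y0%:R - z0%:R - ycoord i - zcoord i.
  by rewrite -(sum_exponents i) yE zE; ring.
have [k0|[k1|k2]] : k = 0 \/ k = 1 \/ k = 2.
  by move: k {uk uE step lt nuD}; apply/forall_ord3; split; tauto.
- by apply: (step (d%:R - y0%:R - z0%:R) (-1) (-1)) => i; rewrite k0 xE; ring.
- by apply: (step y0%:R 1 0) => i; rewrite k1 yE; ring.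
- by apply: (step z0%:R 0 1) => i; rewrite k2 zE; ring.
Qed.

End RowSpace.

(** The factorials make [coef_row_mul] hold: at s = u + e_k the falling factorial of [u] equals s_0!
    s_1! s_2!. *)
Definition coef_row (p : dhomog 3 K d) : 'rV[K]_N :=
  scaled_row (fun i => (\prod_(k < 3) (sv i k)`!%:R) * (p : {mpoly K[3]})@_(sv i)).

Lemma coef_row_is_linear : linear coef_row.
Proof. by move=> e p q; apply/rowP => i; rewrite !mxE /= mcoeffD mcoeffZ; ring. Qed.
HB.instance Definition _ := GRing.isLinear.Build K (dhomog 3 K d) 'rV[K]_N _
  coef_row coef_row_is_linear.

Definition sum_form : dhomog 3 K 1 := indhomog 1 ('X_0 + 'X_1 + 'X_2).

Lemma sum_formE : sum_form = 'X_0 + 'X_1 + 'X_2 :> {mpoly K[3]}.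
Proof.
by rewrite val_indhomog // !rpredD // dhomogX; apply/eqP; exact: mdeg1.
Qed.

Lemma sum_form_coef i : (sum_form : {mpoly K[3]})@_U_(i) = 1.
Proof.
rewrite sum_formE !mcoeffD !mcoeffXU; move: i; apply/forall_ord3.
by rewrite !(add0r, addr0).
Qed.

Lemma coef_row_mul u : mdeg u = D ->
  coef_row (mul_form sum_form (indhomog D 'X_[u])) = scaled_row (falling u).
Proof.
move=> uD; apply/rowP => i; rewrite !mxE; congr (_ * _).
rewrite /= val_indhomogX // sum_formE !mulrDl !mcoeffD -!mpolyXD !mcoeffX.
rewrite /falling; have sE := mdeg_s i; move: (sv i) sE => m mE.
have [le|nle] := boolP (u <= m)%MM; last first.
  have E k : (U_(k) + u == m)%MM = false.
    by apply: contraNF nle => /eqP<-; exact: lem_addl.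
  rewrite !E !addr0 mulr0.
  have [k lt] : exists k, (m k < u k)%N.
    case: (pickP (fun k => m k < u k)%N) => [k|H]; first by exists k.
    by case/mnm_lepP: nle => k; rewrite leqNgt H.
  by rewrite (bigD1 k) //= ffact_small // mul0r.
have muE : m = (u + (m - u))%MM by rewrite addmC submK.
have /eqP/mdeg1P[k /eqP kE] : mdeg (m - u)%MM = 1%N.
  by move/(congr1 mdeg): muE; rewrite mdegD uD mE; lia.
rewrite {}kE in muE; rewrite muE.
have E k' : (U_(k') + u == u + U_(k))%MM = (k' == k).
  by rewrite addmC eqm_add2l; apply/eqP/eqP => [/mnmP/(_ k)|->//];
    rewrite !mnm1E eqxx; case: eqP.
rewrite !E (_ : _ + _ = 1); last first.
  by move: k {muE E}; apply/forall_ord3; rewrite !(add0r, addr0).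
rewrite mulr1; apply: eq_bigr => k' _; rewrite mnmDE mnm1E.
rewrite -(@ffact_fact (u k' + _) (u k')) ?leq_addr // addKn.
by case: eqP; rewrite muln1.
Qed.

Lemma lker_coef_row : lker (linfun coef_row) = graded_piece I d.
Proof.
have fact0 i : \prod_(k < 3) (sv i k)`!%:R != 0 :> K.
  by apply/prodf_neq0 => k _; exact: fact_neq0_char0.
apply/eqP; rewrite eqEsubv; apply/andP; split; apply/subvP => p.
  rewrite memv_ker lfunE /= => /eqP/rowP E; apply/mem_graded_monomial => m mp.
  case: (pselect (U m)) => // nUm; have md := mdeg_msupp_dhomog mp.
  have ms : m \in s by apply/(sU md).
  have lti : (index m s < N)%N by rewrite index_mem.
  move: (E (Ordinal lti)); rewrite !mxE /= nth_index // => /eqP.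
  rewrite mulf_eq0 (negPf (c0 _)) mulf_eq0 /= => /orP[|].
    by have := fact0 (Ordinal lti); rewrite /= nth_index // => /negPf->.
  by rewrite mcoeff_eq0 mp.
move=> /mem_graded_monomial Ip; rewrite memv_ker lfunE /=; apply/eqP/rowP => i.
rewrite !mxE memN_msupp_eq0 ?mulr0 //; apply/negP => /Ip.
by apply/(sU (mdeg_s i)); exact: mem_nth.
Qed.

(** The left side is spanned by the rows of [mono2] up to degree D, the right side by those of
    [falling] in degree D; the exchange lemmas convert each into the other. *)
Lemma osc_spanE : osc_span D (exp_param y0 z0 i0 a)
  = (linfun coef_row @: limg (linfun (@mul_form K 2 D sum_form)))%VS.
Proof.
set W := (_ @: _)%VS.
have rowE nu : deriv_row (exp_param y0 z0 i0 a) nu = scaled_row (mono2 nu).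
  exact: deriv_row_exp.
apply/eqP; rewrite eqEsubv; apply/andP; split.
  apply/span_subvP => _ /mapP[nu _ ->]; rewrite rowE.
  have WD u : mdeg u = D -> scaled_row (falling u) \in W.
    move=> uD; rewrite -coef_row_mul // -(lfunE coef_row); apply: memv_img.
    by apply/limg_mul_formP; exists (indhomog D 'X_[u]).
  have nuD : (mdeg (val nu) + mdeg (0%MM : 'X_{1..3}) <= D)%N.
    by rewrite mdeg0 addn0 -ltnS bmdeg.
  have := mono2_falling_sub (falling_sub WD) nuD.
  congr (_ \in W); apply/rowP => i; rewrite !mxE /falling big1 ?mulr1 // => k _.
  by rewrite mnm0E.
apply/subvP => _ /memv_imgP[_ /limg_mul_formP[q ->] ->].
rewrite lfunE /= [q]dhomogE_sum linear_sum linear_sum big_seq /=; apply: memv_suml => u uq.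
rewrite !linearZ /=; apply: memvZ; rewrite coef_row_mul; last exact: mdeg_msupp_dhomog uq.
have OD nu : (mdeg nu <= D)%N ->
    scaled_row (mono2 nu) \in osc_span D (exp_param y0 z0 i0 a).
  move=> le; rewrite -rowE; apply: memv_span; apply/mapP.
  by exists (BMultinom (le : (mdeg nu < D.+1)%N)); rewrite ?mem_enum.
have uD : (mdeg (0%MM : 'X_{1..2}) + mdeg u <= D)%N.
  by rewrite mdeg0 add0n (mdeg_msupp_dhomog uq).
move: (falling_mono2_sub OD uD); move: (osc_span _ _) => O.
congr (_ \in O); apply/rowP => i; rewrite !mxE /mono2 big1 ?mul1r // => k _.
by rewrite mnm0E.
Qed.

(** The kernel of [coef_row] is [I]_d, so rank-nullity turns the dimension of the image into the
    rank of multiplication on R/I. *)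
Lemma dim_osc_span :
  \dim (osc_span D (exp_param y0 z0 i0 a)) = mul_rank I D sum_form.
Proof.
rewrite osc_spanE /mul_rank -lker_coef_row; set L := limg _; set G := lker _.
have := limg_ker_dim (linfun coef_row) (L + G).
rewrite limgD (_ : (_ @: G) = 0)%VS; last by apply/eqP; rewrite -lkerE.
by rewrite addv0 -/G capvC (capv_idPl (addvSr L G)) => <-; rewrite addKn.
Qed.

End Osculating.

(** * Laplace equations *)

Lemma mem_inv_monomials (K : fieldType) (n : nat) (I : {mpoly K[n.+1]} -> Prop) d m :
  m \in inv_monomials I d <-> mdeg m = d /\ ~ I 'X_[m].
Proof.
split=> [/mapP[mu]|[md nI]].
  by rewrite mem_filter => /andP[/andP[/eqP md /asboolP nI] _] ->.
have lt : (mdeg m < d.+1)%N by rewrite md.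
apply/mapP; exists (BMultinom lt) => //.
by rewrite mem_filter mem_enum /= md eqxx andbT; apply/asboolP.
Qed.

Section Laplace.
Variables (K : closedFieldType) (charK : [pchar K] =i pred0).
Variables (d j : nat).
Hypotheses (j_ge1 : (1 <= j)%N) (j_le : (4 * j <= d - 1)%N).

Local Notation U := (in_genI d j).
Local Notation I := (monomial_ideal (K := K) U).
Local Notation s := (inv_monomials I d).

Lemma mem_inv_monomials_genI m : mdeg m = d -> (m \in s <-> ~ U m).
Proof.
move=> md; split=> [/mem_inv_monomials[_ nI] Um|nU].
  by apply/nI/monomial_idealX.
by apply/mem_inv_monomials; split=> // /monomial_idealX.
Qed.

(** A generator divisible by x has z-exponent 0, 1 or 3, and z-exponent 1 occurs only with
    y-exponent 1 modulo 4. *)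
Lemma base_not_in_genI m : mdeg m = d -> (0 < m 0%R)%N -> (0 < m 2%R)%N ->
  (m 2%R < 3)%N -> (m 2%R = 2 \/ m 1%R %% 4 <> 1)%N -> ~ U m.
Proof.
move=> md m0 m2 m23 H Um; have /(mem_gens j_ge1 j_le)/mapP[i _ E] := conj Um md.
move: m0 m2 m23 H; rewrite E /gen_mnm.
by do ![case: ifP => ?]; rewrite !mnm3E; lia.
Qed.

Lemma satisfies_laplace_genI :
  satisfies_laplace (@inverse_system_variety K 2 I d) (d - 1) j.
Proof.
have d_ge5 : (5 <= d)%N by lia.
have d_gt0 : (0 < d)%N by lia.
have base m : mdeg m = d -> ~ U m -> exists i : 'I_(size s), nth 0%MM s i = m.
  move=> md /(mem_inv_monomials_genI md) ms; have lt : (index m s < size s)%N by rewrite index_mem.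
  by exists (Ordinal lt); rewrite /= nth_index.
have mdeg_s (i : 'I_(size s)) : mdeg (nth 0%MM s i) = d.
  by have /mem_inv_monomials[] := mem_nth 0%MM (ltn_ord i).
(* The neighbours are built on x^(d-3) y^2 z: with z-exponent 1 the y-exponents 2 and 3 are not 1
   modulo 4, and the third monomial has z-exponent 2. *)
have [x0 dE] : exists x0, d = (x0 + 4)%N by exists (d - 4)%N; lia.
have [i0 si0] : exists i : 'I_(size s), nth 0%MM s i = mnm3 x0.+1 2 1.
  apply: base; first by rewrite mdeg3 !mnm3E; lia.
  by apply: base_not_in_genI; rewrite ?mdeg3 !mnm3E; lia.
have [i1 si1] : exists i : 'I_(size s), nth 0%MM s i = mnm3 x0 3 1.
  apply: base; first by rewrite mdeg3 !mnm3E; lia.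
  by apply: base_not_in_genI; rewrite ?mdeg3 !mnm3E; lia.
have [i2 si2] : exists i : 'I_(size s), nth 0%MM s i = mnm3 x0 2 2.
  apply: base; first by rewrite mdeg3 !mnm3E; lia.
  by apply: base_not_in_genI; rewrite ?mdeg3 !mnm3E; lia.
exists 2; first exact: (has_dim_toric charK d_gt0 mdeg_s si0 si1 si2).
(* The open set is where all coordinates are nonzero; it meets X in the image of (1, 1, 1). *)
pose ones : 'X_{1..size s} := [multinom 1%N | i < size s].
exists (size s, 'X_[ones]).
  split=> /=.
    rewrite dhomogX; apply/eqP; rewrite /= mdegE; under eq_bigr do rewrite mnmE.
    by rewrite sum1_card card_ord.
  have one0 (k : 'I_3) : (1 : K) != 0 by exact: oner_neq0.
  have N_gt0 : (0 < size s)%N by exact: leq_ltn_trans (leq0n i0) (ltn_ord i0).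
  move=> /(_ _ (@monomial_map_in K s N_gt0 (fun=> 1) one0)).
  apply/eqP; rewrite mevalX; apply/prodf_neq0 => i _.
  by rewrite expf_neq0 // monomial_map_neq0.
move=> P XP /=; rewrite mevalX => /prodf_neq0 P1.
have P0 i : P i != 0.
  by have := P1 i isT; rewrite mnmE expr1.
have [a a0 ->] := toric_torus d_gt0 mdeg_s si0 si1 si2 XP P0.
split; first exact: (smooth_torus charK d_gt0 mdeg_s si0 si1 si2).
exists (exp_param 2 1 i0 a).
  exact: (local_param_exp charK d_gt0 mdeg_s si0 si1 si2).
have dim_osc D : d = D.+1 ->
    \dim (osc_span D (exp_param (K := K) 2 1 i0 a)) = mul_rank I D (sum_form K).
  move=> dD; apply: (dim_osc_span charK _ _ 2 1 i0 a0) => [i|m md]; first by rewrite -dD.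
  by apply: mem_inv_monomials_genI; rewrite dD.
have -> := dim_osc (d - 1)%N; last by lia.
(* No coefficient of x + y + z vanishes, so this particular form is general enough for
   [mul_rank_eq]. *)
have form_neq0 i : (sum_form K : {mpoly K[3]})@_U_(i) != 0.
  by rewrite sum_form_coef oner_neq0.
have dK : (d - 1).+1 = d by lia.
have := mul_rank_eq charK j_ge1 j_le form_neq0 dK.
have <- : 'C(2 + (d - 1), d - 1) = 'C(d.+1, 2).
  by rewrite -(@bin_sub (2 + (d - 1)) (d - 1)) ?leq_addl // addnK; congr 'C(_, _); lia.
by move=> <-; rewrite PoszD [RHS]addrAC addrK.
Qed.

End Laplace.

Theorem corollary11p17 (K : closedFieldType) (charK : [pchar K] =i pred0)
    (d j : nat) (j_ge1 : (1 <= j)%N) (j_le : (4 * j <= d - 1)%N) :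
  [/\ (forall i : nat, i <> (d - 1)%N ->
         has_WLP_in_degree (@ideal_I K d j) i) /\
      general_form (fun l : dhomog 3 K 1 => forall i : nat,
         ((i.+1 < d)%N -> mul_injective (@ideal_I K d j) i l) /\
         ((i.+1 > d)%N -> mul_surjective (@ideal_I K d j) i l)),
      fails_WLP_by (@ideal_I K d j) (d - 1) j
    & satisfies_laplace
        (@inverse_system_variety K 2 (@ideal_I K d j) d) (d - 1) j].
Proof.
split.
- split; first by move=> i; exact: has_WLP_ideal_I.
  exact: general_injective_surjective_ideal_I.
- exact: fails_WLP_ideal_I.
- by rewrite ideal_IE //; exact: satisfies_laplace_genI.
Qed.
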